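(* Let $D\subseteq\mathbb{C}$ be a domain equipped with a metric $\rho$ with corresponding distance $d=d_\rho$, such that (1) $C_\rho:=\inf_{\zeta\in D}\rho(\zeta)>0$; (2) $d(\zeta,\eta)\to\infty$ as $\zeta\to\partial D$, for every $\eta\in D$. Let $\alpha\in(0,1]$. An analytic mapping $f:\mathbb{D}\to D$ on the unit disk $\mathbb{D}$ satisfies $$f^\ast(z)=\mathcal{O}\big((1-|z|)^{\alpha-1}\big),\quad |z|\to1,$$ if and only if $f$ has a continuous extension to $\overline{\mathbb{D}}$ and its boundary function $f_b$, $f_b(t)=f(e^{it})$, belongs to $\rho\Lambda_\alpha$.
   Context: $\mathbb{D}$ is the open unit disk in $\mathbb{C}$. A metric $\rho$ on a domain $D\subseteq\mathbb{C}$ is a positive continuous function on $D$. The $\rho$-distance is $d_\rho(\zeta,\eta)=\inf_\gamma\int_\gamma\rho(\omega)\,|d\omega|$, the infimum being over all piecewise $\mathcal{C}^1$-smooth curves $\gamma$ in $D$ joining $\zeta$ and $\eta$. For an analytic mapping $f:\mathbb{D}\to D$, the $\rho$-derivative of $f$ is $f^\ast(z)=\lim_{w\to z}\frac{d_\rho(f(z),f(w))}{|z-w|}=\rho(f(z))\,|f'(z)|$, $z\in\mathbb{D}$. For $\alpha\in(0,1]$, $\rho\Lambda_\alpha$ is the class of all $2\pi$-periodic functions $\phi:\mathbb{R}\to D$ (values in $D$) such that $\sup_{|s-t|<h}d_\rho(\phi(t),\phi(s))=\mathcal{O}(h^\alpha)$ as $h\to0$. The continuous extension of $f$ to $\overline{\mathbb{D}}$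 is a priori complex-valued; membership $f_b\in\rho\Lambda_\alpha$ includes that $f_b$ takes values in $D$. The boundary $\partial D$ is taken in the extended plane $\overline{\mathbb{C}}$. *)

(* Defs.v *)
From Stdlib Require Import Reals.
From Coquelicot Require Import Coquelicot.
Open Scope R_scope.

Definition connected (D : C -> Prop) : Prop :=
  forall U V : C -> Prop, open U -> open V ->
    (forall z, D z -> U z \/ V z) ->
    (exists z, D z /\ U z) -> (exists z, D z /\ V z) ->
    exists z, D z /\ U z /\ V z.

Definition plane_domain (D : C -> Prop) : Prop :=
  (exists z, D z) /\ open D /\ connected D.

(* Values of [rho] outside [D] are never used. *)
Definition metric_on (D : C -> Prop) (rho : C -> R) : Prop :=
  (forall z, D z -> 0 < rho z) /\ continuous_on D rho.

Definition inf_metric (D : C -> Prop) (rho : C -> R) : Rbar :=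
  Glb_Rbar (fun r => exists z, D z /\ r = rho z).

(* The derivative is taken along [a, b], hence one-sided at the endpoints. *)
Definition C1_on (g : R -> C) (a b : R) : Prop :=
  exists dg : R -> C,
    (forall t, a <= t <= b ->
       filterdiff g (within (fun s => a <= s <= b) (locally t))
         (fun h : R => scal h (dg t))) /\
    continuous_on (fun s => a <= s <= b) dg.

(* Continuity at the break points is automatic: the same [g] is differentiable
   along the closed intervals on both sides. *)
Inductive piecewise_C1 (g : R -> C) : R -> R -> Prop :=
| piecewise_C1_arc (a b : R) :
    a < b -> C1_on g a b -> piecewise_C1 g a b
| piecewise_C1_cons (a b c : R) :
    a < b -> C1_on g a b -> piecewise_C1 g b c -> piecewise_C1 g a c.

Definition velocity (g : R -> C) (t : R) : C :=
  (Derive (fun s => Re (g s)) t, Derive (fun s => Im (g s)) t).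

(* For a piecewise C^1 curve, [velocity] can be meaningless only at the break
   points and at [a], [b]; these finitely many values do not affect [RInt]. *)
Definition rho_length (rho : C -> R) (g : R -> C) (a b : R) : R :=
  RInt (fun t => rho (g t) * Cmod (velocity g t)) a b.

Definition joins (D : C -> Prop) (zeta eta : C) (g : R -> C) (a b : R) : Prop :=
  piecewise_C1 g a b /\ (forall t, a <= t <= b -> D (g t)) /\
  g a = zeta /\ g b = eta.

(* Only meaningful for [zeta] and [eta] in [D]: otherwise the infimum is over
   the empty set and [real] maps it to [0]. *)
Definition rho_dist (D : C -> Prop) (rho : C -> R) (zeta eta : C) : R :=
  real (Glb_Rbar (fun l => exists (g : R -> C) (a b : R),
    joins D zeta eta g a b /\ l = rho_length rho g a b)).

(* [None] is the point at infinity. *)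
Definition ext_plane : Type := option C.

Definition ext_locally (p : ext_plane) (P : ext_plane -> Prop) : Prop :=
  match p with
  | Some z => locally z (fun w => P (Some w))
  | None => P None /\ exists M : R, forall w : C, M < Cmod w -> P (Some w)
  end.

Definition ext_embed (D : C -> Prop) (p : ext_plane) : Prop :=
  match p with Some z => D z | None => False end.

Definition ext_boundary (D : C -> Prop) (p : ext_plane) : Prop :=
  forall P, ext_locally p P ->
    (exists q, P q /\ ext_embed D q) /\ (exists q, P q /\ ~ ext_embed D q).

(* Trace on [D] of the neighbourhoods of the set [ext_boundary D]. *)
Definition to_boundary (D : C -> Prop) : (C -> Prop) -> Prop :=
  fun P => forall p, ext_boundary D p ->
    ext_locally p
      (fun q => match q with Some z => D z -> P z | None => True end).

Definition disk (z : C) : Prop := Cmod z < 1.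
Definition closed_disk (z : C) : Prop := Cmod z <= 1.

(* [ex_derive] is taken over the field [C]: complex differentiability. *)
Definition analytic_map (f : C -> C) (D : C -> Prop) : Prop :=
  (forall z, disk z -> D (f z)) /\ (forall z : C, disk z -> ex_derive f z).

Definition rho_deriv (D : C -> Prop) (rho : C -> R) (f : C -> C) (z : C) : R :=
  lim (filtermap (fun w => rho_dist D rho (f z) (f w) / Cmod (z - w)%C)
         (locally' z)).

(* [u] may be infinite-valued (it can be a supremum); the bound forces it to be
   finite eventually. *)
Definition big_O {T : Type} (F : (T -> Prop) -> Prop) (u : T -> Rbar)
    (v : T -> R) : Prop :=
  exists K : R, F (fun x => Rbar_le (Rbar_abs (u x)) (Finite (K * Rabs (v x)))).

(* |z| -> 1 with z in the unit disk, uniformly in the argument of z. *)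
Definition to_circle : (C -> Prop) -> Prop :=
  fun P => at_left 1 (fun r => forall z, Cmod z = r -> P z).

Definition modulus (D : C -> Prop) (rho : C -> R) (phi : R -> C) (h : R) : Rbar :=
  Lub_Rbar (fun x => exists s t : R,
    Rabs (s - t) < h /\ x = rho_dist D rho (phi t) (phi s)).

Definition rho_Lambda (D : C -> Prop) (rho : C -> R) (alpha : R)
    (phi : R -> C) : Prop :=
  (forall t, phi (t + 2 * PI) = phi t) /\
  (forall t, D (phi t)) /\
  big_O (at_right 0) (modulus D rho phi) (fun h => Rpower h alpha).

Definition continuous_extension (f F : C -> C) : Prop :=
  (forall z, disk z -> F z = f z) /\ continuous_on closed_disk F.

Definition boundary_function (F : C -> C) (t : R) : C := F (cos t, sin t).

(* Main.v *)
(* Along a path the distance d(f(z), f(w)) is controlled by integrating f*.  If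
   f* <= K (1-|z|)^(alpha-1), then on radii d(f(rz), f(r'z)) <= (K/alpha) (1-r)^alpha,
   and on the circle of radius 1-h an arc of length h costs K h^alpha.  Since
   |z - w| <= d(z, w) / C_rho, radial limits exist; they lie in D because d stays bounded
   along the radius, and going in by h, around, and out again gives the Hoelder
   condition for f_b in the distance d.

   Conversely, f_b is Hoelder in the Euclidean sense and rho o f is bounded, f being
   continuous from the compact closed disk into D, so it suffices to bound f'.  By the
   maximum principle, f(e^(ia) z) - f(z) is bounded by A h^alpha for |a| < h on the whole disk.
   Cauchy's formula for f'(z) on a circle about z, with the kernel made odd under
   reflection in the radius through z, involves only such differences; this also
   covers alpha = 1, where the usual Cauchy estimate loses a logarithm. *)

Require Import Defs.
From Stdlib Require Import Reals Lra Lia Psatz Classical IndefiniteDescription.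
From Coquelicot Require Import Coquelicot.
Open Scope R_scope.

(** [f] is only known to be complex differentiable at each point, so neither the length of [f o w]
    nor a contour integral of the derivative is at hand. The passages from local to global therefore
    go mostly through bisection of a square: it yields the closedness of holomorphic forms, the
    maximum of a continuous function on the closed disk, and the integration of a local distance
    estimate. Circular means are the only integrals of analytic functions; they give the maximum
    principle and, for an increment times a kernel, the bound on the derivative. The infimum
    defining the distance is bounded below by test functions whose local growth [rho] controls, and
    above by segments in small balls. Distances are estimated in both orders of the arguments, so
    that no curve has to be reversed. *)

Lemma nested_intervals_point (x : nat -> R) :
  (forall n, x n <= x (S n) /\ x (S n) + (/2) ^ S n <= x n + (/2) ^ n) ->
  exists l, forall n, x n <= l <= x n + (/2) ^ n.
Proof.
  intros Hx.
  assert (Hpos : forall n, 0 < (/2) ^ n) by (intros n; apply pow_lt; lra).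
  assert (Hmono : forall n k, x n <= x (n + k)%nat /\
            x (n + k)%nat + (/2) ^ (n + k) <= x n + (/2) ^ n).
  { intros n k; induction k as [|k IH].
    - rewrite Nat.add_0_r; lra.
    - rewrite Nat.add_succ_r. specialize (Hx (n + k)%nat). lra. }
  (* Every left end lies below every right end, so the supremum of the left ends belongs to all the
     intervals. *)
  assert (Hcross : forall n m, x m <= x n + (/2) ^ n).
  { intros n m. destruct (Nat.le_gt_cases n m) as [H|H].
    - destruct (Hmono n (m - n)%nat) as [_ H2].
      replace (n + (m - n))%nat with m in H2 by lia. specialize (Hpos m). lra.
    - destruct (Hmono m (n - m)%nat) as [H1 _].
      replace (m + (n - m))%nat with n in H1 by lia. specialize (Hpos n). lra. }
  destruct (completeness (fun r => exists n, r = x n)) as [l [Hub Hlub]].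
  - exists (x 0%nat + (/2) ^ 0). intros r [n ->]. apply Hcross.
  - exists (x 0%nat), 0%nat; reflexivity.
  - exists l. intros n; split.
    + apply Hub; exists n; reflexivity.
    + apply Hlub. intros r [m ->]. apply Hcross.
Qed.

(* Cousin's lemma in the plane. *)
Lemma square_induction (P : R -> R -> R -> Prop) :
  (forall x y s, 0 < s -> 0 <= x -> x + s <= 1 -> 0 <= y -> y + s <= 1 ->
     P x y (s / 2) -> P (x + s / 2) y (s / 2) ->
     P x (y + s / 2) (s / 2) -> P (x + s / 2) (y + s / 2) (s / 2) -> P x y s) ->
  (forall x y, 0 <= x <= 1 -> 0 <= y <= 1 ->
     exists d, 0 < d /\ forall x' y' s, 0 < s < d ->
       0 <= x' <= x -> x <= x' + s <= 1 ->
       0 <= y' <= y -> y <= y' + s <= 1 -> P x' y' s) ->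
  P 0 0 1.
Proof.
  intros Hsplit Hloc. apply NNPP; intros HN.
  assert (Hpos : forall n, 0 < (/2) ^ n) by (intros n; apply pow_lt; lra).
  pose (inside := fun (p : R * R) s =>
    0 <= fst p /\ fst p + s <= 1 /\ 0 <= snd p /\ snd p + s <= 1).
  (* The depth is part of the state so that one function [step] can be chosen for all sides
     [(/2) ^ n]. The first of three quarters that fails is kept; if all three hold, [Hsplit] makes
     the fourth fail. *)
  assert (Hstep : forall q : nat * (R * R), exists p' : R * R,
    let s := (/2) ^ fst q in let p := snd q in
    (p' = p \/ p' = (fst p + s / 2, snd p) \/ p' = (fst p, snd p + s / 2)
      \/ p' = (fst p + s / 2, snd p + s / 2)) /\
    (inside p s -> ~ P (fst p) (snd p) s -> ~ P (fst p') (snd p') (s / 2))).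
  { intros [n [x y]]; simpl. set (s := (/2) ^ n).
    destruct (classic (P x y (s / 2))) as [H1|H1];
      [|exists (x, y); tauto].
    destruct (classic (P (x + s / 2) y (s / 2))) as [H2|H2];
      [|exists (x + s / 2, y); simpl; tauto].
    destruct (classic (P x (y + s / 2) (s / 2))) as [H3|H3];
      [|exists (x, y + s / 2); simpl; tauto].
    exists (x + s / 2, y + s / 2); simpl; split; [tauto|].
    intros (A1 & A2 & A3 & A4) H H4. apply H. apply Hsplit; auto. apply Hpos. }
  destruct (functional_choice _ Hstep) as [step Hst]; simpl in Hst.
  pose (sq := fix sq (n : nat) : R * R :=
    match n with O => (0, 0) | S m => step (m, sq m) end).
  assert (Hhalf : forall n, (/2) ^ S n = (/2) ^ n / 2) by (intros; simpl; field).
  assert (Hq : forall n,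
     (fst (sq n) <= fst (sq (S n)) /\
      fst (sq (S n)) + (/2) ^ S n <= fst (sq n) + (/2) ^ n) /\
     (snd (sq n) <= snd (sq (S n)) /\
      snd (sq (S n)) + (/2) ^ S n <= snd (sq n) + (/2) ^ n)).
  { intros n. rewrite Hhalf. destruct (Hst (n, sq n)) as [H _].
    simpl in H. change (sq (S n)) with (step (n, sq n)). specialize (Hpos n).
    destruct H as [H|[H|[H|H]]]; rewrite H; simpl; lra. }
  assert (Hin : forall n, inside (sq n) ((/2) ^ n)).
  { induction n as [|n IH]; unfold inside in *.
    - simpl; lra.
    - specialize (Hq n). lra. }
  assert (HnP : forall n, ~ P (fst (sq n)) (snd (sq n)) ((/2) ^ n)).
  { induction n as [|n IH].
    - simpl. exact HN.
    - rewrite Hhalf. apply (Hst (n, sq n)); [apply Hin|exact IH]. }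
  destruct (nested_intervals_point (fun n => fst (sq n))) as [x Hx];
    [intros n; apply Hq|].
  destruct (nested_intervals_point (fun n => snd (sq n))) as [y Hy];
    [intros n; apply Hq|].
  destruct (Hloc x y) as [d [Hd Hd']].
  - generalize (Hx 0%nat); simpl; lra.
  - generalize (Hy 0%nat); simpl; lra.
  - destruct (pow_lt_1_zero (/2)) with (y := d) as [N HNd];
      [rewrite Rabs_pos_eq; lra|lra|].
    specialize (HNd N (le_n N)). rewrite Rabs_pos_eq in HNd;
      [|left; apply Hpos].
    apply (HnP N). generalize (Hx N) (Hy N) (Hin N) (Hpos N).
    unfold inside. intros. apply Hd'; lra.
Qed.

(* Integrates a local estimate.  With [m s t = d (Phi s) (Phi t) - (B t - B s)] it bounds
   distances along [Phi = f o w] without the length of [Phi], which would need [f'] continuous. *)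
Lemma subadditive_interval_nonpos (m : R -> R -> R) (a b : R) :
  a < b ->
  (forall x y z, a <= x -> x <= y -> y <= z -> z <= b -> m x z <= m x y + m y z) ->
  (forall t, a <= t <= b -> forall eps, 0 < eps -> exists d, 0 < d /\
     forall s, a <= s <= b -> Rabs (s - t) < d ->
       (s <= t -> m s t <= eps * (t - s)) /\ (t <= s -> m t s <= eps * (s - t))) ->
  m a b <= 0.
Proof.
  intros Hab Hsub Hloc.
  apply le_epsilon; intros e He.
  set (L := b - a). assert (HL : 0 < L) by (unfold L; lra).
  set (eps := e / L). assert (Heps : 0 < eps) by (unfold eps; apply Rdiv_lt_0_compat; lra).
  cut (m (a + L * 0) (a + L * (0 + 1)) <= eps * L * 1).
  { replace (a + L * 0) with a by ring. replace (a + L * (0 + 1)) with b by (unfold L; ring).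
    replace (eps * L * 1) with e by (unfold eps; field; lra). lra. }
  (* A predicate constant in the second coordinate turns the planar bisection into one of the
     interval, rescaled to [[0, 1]]. *)
  apply (square_induction (fun x _ s => m (a + L * x) (a + L * (x + s)) <= eps * L * s)).
  - intros x y s Hs Hx Hxs _ _ H1 H2 _ _.
    replace (x + s / 2 + s / 2) with (x + s) in H2 by field.
    assert (m (a + L * x) (a + L * (x + s)) <=
      m (a + L * x) (a + L * (x + s / 2)) + m (a + L * (x + s / 2)) (a + L * (x + s))).
    { apply Hsub; unfold L in *; nra. }
    lra.
  - intros x y Hx _.
    destruct (Hloc (a + L * x)) with (eps := eps) as [d [Hd Hd']];
      [unfold L in *; nra|exact Heps|].
    exists (d / L). split; [apply Rdiv_lt_0_compat; lra|].
    intros x' y' s Hs Hx' Hxs _ _.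
    assert (Hsd : L * s < d).
    { replace d with (L * (d / L)) by (field; lra). apply Rmult_lt_compat_l; lra. }
    assert (m (a + L * x') (a + L * (x' + s)) <=
      m (a + L * x') (a + L * x) + m (a + L * x) (a + L * (x' + s))).
    { apply Hsub; unfold L in *; nra. }
    assert (Hl : m (a + L * x') (a + L * x) <= eps * (a + L * x - (a + L * x'))).
    { apply Hd'; [unfold L in *; nra| |nra]. apply Rabs_def1; nra. }
    assert (Hr : m (a + L * x) (a + L * (x' + s)) <= eps * (a + L * (x' + s) - (a + L * x))).
    { apply Hd'; [unfold L in *; nra| |nra]. apply Rabs_def1; nra. }
    nra.
Qed.

(** * Topology of the plane in terms of [Cmod] *)

(** Balls of the product structure on [C] are squares; comparing [Cmod] with the larger coordinate
    exchanges them for round discs, the form used in all estimates below. *)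
Lemma locally_Cmod (z : C) (P : C -> Prop) :
  locally z P <-> exists d, 0 < d /\ forall w, Cmod (w - z) < d -> P w.
Proof.
  split.
  - intros [d Hd]. exists d. split; [apply cond_pos|].
    intros w Hw. apply Hd. generalize (Rmax_Cmod (w - z)%C); intros Hm.
    split; apply Rle_lt_trans with (2 := Hw); apply Rle_trans with (2 := Hm);
      [apply Rmax_l|apply Rmax_r].
  - intros [d [Hd Hd']]. assert (Hd2 : 0 < d / 2) by lra.
    exists (mkposreal _ Hd2). intros w [H1 H2]. apply Hd'.
    apply Rle_lt_trans with (1 := Cmod_2Rmax _).
    assert (Hm : Rmax (Rabs (fst (w - z)%C)) (Rabs (snd (w - z)%C)) < d / 2)
      by (apply Rmax_lub_lt; assumption).
    assert (Hs : sqrt 2 <= 2).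
    { rewrite <- (sqrt_Rsqr 2) at 2 by lra. apply sqrt_le_1; unfold Rsqr; lra. }
    generalize (sqrt_pos 2) (Rabs_pos (fst (w - z)%C)) (Rmax_l (Rabs (fst (w - z)%C)) (Rabs (snd (w - z)%C))).
    nra.
Qed.

Lemma continuous_on_C (A : C -> Prop) (f : C -> C) :
  continuous_on A f <-> forall z, A z -> forall eps, 0 < eps ->
    exists d, 0 < d /\ forall w, A w -> Cmod (w - z) < d -> Cmod (f w - f z) < eps.
Proof.
  split.
  - intros H z Hz eps Heps.
    assert (Hl : locally (f z) (fun v => Cmod (v - f z) < eps))
      by (apply locally_Cmod; exists eps; auto).
    specialize (H z Hz _ Hl). apply locally_Cmod in H. destruct H as [d [Hd H]].
    exists d; split; auto.
  - intros H z Hz P HP. apply locally_Cmod in HP. destruct HP as [e [He HP]].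
    destruct (H z Hz e He) as [d [Hd H']].
    apply locally_Cmod. exists d; split; [exact Hd|].
    intros w Hw HAw. apply HP; auto.
Qed.

Lemma continuous_on_R (A : C -> Prop) (f : C -> R) :
  continuous_on A f <-> forall z, A z -> forall eps, 0 < eps ->
    exists d, 0 < d /\ forall w, A w -> Cmod (w - z) < d -> Rabs (f w - f z) < eps.
Proof.
  split.
  - intros H z Hz eps Heps.
    assert (Hl : locally (f z) (fun v => Rabs (v - f z) < eps))
      by (exists (mkposreal _ Heps); intros v Hv; exact Hv).
    specialize (H z Hz _ Hl). apply locally_Cmod in H. destruct H as [d [Hd H]].
    exists d; split; auto.
  - intros H z Hz P [e HP].
    destruct (H z Hz e (cond_pos e)) as [d [Hd H']].
    apply locally_Cmod. exists d; split; [exact Hd|].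
    intros w Hw HAw. apply HP, H'; auto.
Qed.

Lemma open_Cmod (A : C -> Prop) :
  open A -> forall z, A z -> exists d, 0 < d /\ forall w, Cmod (w - z) < d -> A w.
Proof. intros H z Hz. apply locally_Cmod, H, Hz. Qed.

Lemma Cmod_triangle_sub (z w v : C) : Cmod (z - v) <= Cmod (z - w) + Cmod (w - v).
Proof. replace (z - v)%C with ((z - w) + (w - v))%C by ring. apply Cmod_triangle. Qed.

Lemma Cmod_sub_sym (z w : C) : Cmod (z - w) = Cmod (w - z).
Proof. rewrite <- Cmod_opp. f_equal. ring. Qed.

Lemma Cmod_le_abs (z : C) : Cmod z <= Rabs (fst z) + Rabs (snd z).
Proof.
  destruct z as [x y].
  replace (x, y) with (RtoC x + Ci * RtoC y)%C
    by (unfold RtoC, Ci, Cplus, Cmult; simpl; f_equal; ring).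
  apply Rle_trans with (1 := Cmod_triangle _ _).
  rewrite Cmod_mult, Cmod_Ci, !Cmod_R. simpl. right.
  rewrite !Rmult_0_l, !Rmult_1_l. f_equal; f_equal; ring.
Qed.

(* Bisection instead of sequential compactness: if [h] stayed below its
   supremum, it would be bounded away from it on the whole disk. *)
Lemma closed_disk_max (h : C -> R) :
  continuous_on closed_disk h ->
  exists z0, closed_disk z0 /\ forall z, closed_disk z -> h z <= h z0.
Proof.
  intros Hc0. assert (Hc := proj1 (continuous_on_R closed_disk h) Hc0). clear Hc0.
  set (below := fun c => exists M, c M /\ forall z, closed_disk z -> h z <= M).
  (* Compactness in the form needed here: admissible local bounds, closed under maximum, combine
     into one admissible global bound. Taking all reals as admissible gives boundedness; taking the
     reals below the supremum [S] contradicts non-attainment. *)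
  assert (Hind : forall c : R -> Prop,
     (forall M N, c M -> c N -> c (Rmax M N)) -> (exists M, c M) ->
     (forall z, closed_disk z -> exists M, c M /\ h z < M) -> below c).
  { intros c Hmax [M0 HM0] Hpt.
    assert (H : exists M, c M /\ forall z, closed_disk z ->
       -1 + 2 * 0 <= fst z <= -1 + 2 * (0 + 1) ->
       -1 + 2 * 0 <= snd z <= -1 + 2 * (0 + 1) -> h z <= M).
    { apply (square_induction (fun x y s => exists M, c M /\ forall z, closed_disk z ->
         -1 + 2 * x <= fst z <= -1 + 2 * (x + s) ->
         -1 + 2 * y <= snd z <= -1 + 2 * (y + s) -> h z <= M)).
      - intros x y s Hs _ _ _ _ [M1 [C1 H1]] [M2 [C2 H2]] [M3 [C3 H3]] [M4 [C4 H4]].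
        exists (Rmax (Rmax M1 M2) (Rmax M3 M4)). split; [auto|].
        intros z Hz Hx Hy.
        assert (HM : h z <= M1 \/ h z <= M2 \/ h z <= M3 \/ h z <= M4).
        { destruct (Rle_dec (fst z) (-1 + 2 * (x + s / 2)));
          destruct (Rle_dec (snd z) (-1 + 2 * (y + s / 2))).
          - left; apply H1; auto; lra.
          - right; right; left; apply H3; auto; lra.
          - right; left; apply H2; auto; lra.
          - right; right; right; apply H4; auto; lra. }
        generalize (Rmax_l M1 M2) (Rmax_r M1 M2) (Rmax_l M3 M4) (Rmax_r M3 M4)
          (Rmax_l (Rmax M1 M2) (Rmax M3 M4)) (Rmax_r (Rmax M1 M2) (Rmax M3 M4)).
        intros; destruct HM as [?|[?|[?|?]]]; lra.
      - intros x y Hx Hy. set (p := (-1 + 2 * x, -1 + 2 * y) : C).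
        destruct (classic (closed_disk p)) as [Hp|Hp].
        + destruct (Hpt p Hp) as [M [HM HpM]].
          destruct (Hc p Hp (M - h p)) as [d [Hd Hd']]; [lra|].
          exists (d / 8). split; [lra|].
          intros x' y' s Hs Hx' Hxs Hy' Hys. exists M. split; [exact HM|].
          intros z Hz H1 H2. assert (Hzp : Rabs (h z - h p) < M - h p).
          { apply Hd'; [exact Hz|]. apply Rle_lt_trans with (1 := Cmod_le_abs _).
            assert (Rabs (fst (z - p)%C) < d / 2).
            { simpl; apply Rabs_def1; lra. }
            assert (Rabs (snd (z - p)%C) < d / 2).
            { simpl; apply Rabs_def1; lra. }
            lra. }
          apply Rabs_def2 in Hzp. lra.
        (* Small squares around a point outside the disk miss the disk, so any admissible value
           serves as a bound there. *)
        + set (d := Cmod p - 1). assert (Hd : 0 < d) by (unfold closed_disk, d in *; lra).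
          exists (d / 8). split; [lra|].
          intros x' y' s Hs Hx' Hxs Hy' Hys. exists M0. split; [exact HM0|].
          intros z Hz H1 H2. exfalso.
          assert (Cmod (p - z) < d).
          { apply Rle_lt_trans with (1 := Cmod_le_abs _).
            assert (Rabs (fst (p - z)%C) < d / 2).
            { simpl; apply Rabs_def1; lra. }
            assert (Rabs (snd (p - z)%C) < d / 2).
            { simpl; apply Rabs_def1; lra. }
            lra. }
          generalize (Cmod_triangle (p - z) z). replace (p - z + z)%C with p by ring.
          unfold closed_disk, d in *. lra. }
    destruct H as [M [HM H]]. exists M. split; [exact HM|].
    intros z Hz. generalize (Rmax_Cmod z) (Rmax_l (Rabs (fst z)) (Rabs (snd z)))
      (Rmax_r (Rabs (fst z)) (Rabs (snd z))). unfold closed_disk in Hz. intros.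
    assert (Hf : Rabs (fst z) <= 1) by lra. assert (Hs : Rabs (snd z) <= 1) by lra.
    apply Rabs_le_between in Hf. apply Rabs_le_between in Hs.
    apply H; [exact Hz|lra|lra]. }
  destruct (Hind (fun _ => True)) as [B [_ HB]]; [auto|exists 0; auto| |].
  { intros z _. exists (h z + 1). split; [auto|lra]. }
  assert (H0 : closed_disk 0) by (unfold closed_disk; rewrite Cmod_0; lra).
  destruct (completeness (fun r => exists z, closed_disk z /\ r = h z)) as [S [HS1 HS2]].
  - exists B. intros r [z [Hz ->]]; auto.
  - exists (h 0), 0; auto.
  - apply NNPP; intros HN.
    destruct (Hind (fun M => M < S)) as [M [HM HhM]].
    + intros; apply Rmax_lub_lt; auto.
    + exists (S - 1); lra.
    + intros z Hz. assert (h z < S).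
      { assert (h z <= S) by (apply HS1; exists z; auto).
        destruct (Rle_lt_or_eq_dec _ _ H) as [|E]; [assumption|].
        exfalso; apply HN. exists z; split; [exact Hz|].
        intros w Hw. rewrite E. apply HS1; exists w; auto. }
      exists ((h z + S) / 2). lra.
    + assert (S <= M); [|lra]. apply HS2. intros r [z [Hz ->]]; auto.
Qed.

(** * Goursat's theorem and the mean value property *)

Lemma differentiable_pt_lim_continuous_x (P : R -> R -> R) (x y p q : R) :
  differentiable_pt_lim P x y p q -> continuous (fun u => P u y) x.
Proof.
  intros H. apply @ex_derive_continuous. exists (p * 1 + q * 0).
  apply is_derive_Reals.
  apply (derivable_pt_lim_comp_2d P (fun u => u) (fun _ => y)); [exact H| |].
  - apply derivable_pt_lim_id.
  - apply derivable_pt_lim_const.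
Qed.

Lemma differentiable_pt_lim_continuous_y (P : R -> R -> R) (x y p q : R) :
  differentiable_pt_lim P x y p q -> continuous (fun v => P x v) y.
Proof.
  intros H. apply @ex_derive_continuous. exists (p * 0 + q * 1).
  apply is_derive_Reals.
  apply (derivable_pt_lim_comp_2d P (fun _ => x) (fun v => v)); [exact H| |].
  - apply derivable_pt_lim_const.
  - apply derivable_pt_lim_id.
Qed.

(* [RInt] types its integrands in [R_CompleteNormedModule], which [ring] does not see as [R]. *)
Ltac Rring := match goal with |- @eq _ ?a ?b => change (@eq R a b) end; ring.

Lemma RInt_Rplus (f g : R -> R) (a b : R) : ex_RInt f a b -> ex_RInt g a b ->
  RInt (fun x => f x + g x) a b = RInt f a b + RInt g a b.
Proof. intros Hf Hg. exact (RInt_plus f g a b Hf Hg). Qed.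

Lemma RInt_Rminus (f g : R -> R) (a b : R) : ex_RInt f a b -> ex_RInt g a b ->
  RInt (fun x => f x - g x) a b = RInt f a b - RInt g a b.
Proof. intros Hf Hg. exact (RInt_minus f g a b Hf Hg). Qed.

Lemma RInt_Rconst (a b c : R) : RInt (fun _ => c) a b = (b - a) * c.
Proof. exact (RInt_const a b c). Qed.

Lemma RInt_near_const (g : R -> R) (a b k e : R) :
  a <= b -> ex_RInt g a b -> (forall x, a <= x <= b -> Rabs (g x - k) <= e) ->
  Rabs (RInt g a b - k * (b - a)) <= (b - a) * e.
Proof.
  intros Hab Hg Hk.
  assert (Hconst : ex_RInt (fun _ : R => k) a b) by apply @ex_RInt_const.
  replace (RInt g a b - k * (b - a)) with (RInt (fun x => g x - k) a b).
  - apply abs_RInt_le_const; [exact Hab| |exact Hk].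
    exact (ex_RInt_minus g (fun _ => k) a b Hg Hconst).
  - rewrite (RInt_Rminus g (fun _ => k)) by assumption. rewrite RInt_Rconst.
    apply (f_equal (Rminus _)), Rmult_comm.
Qed.

(** The integral of [P dx + Q dy] around the rectangle. The shared [k] says that the form is closed
    at each point: the affine parts at that point integrate to zero, the remainder is small against
    the area, and the boundary integral is additive under quartering. *)
Lemma goursat_rectangle (P Q : R -> R -> R) (a b c d : R) :
  a < b -> c < d ->
  (forall x y, a <= x <= b -> c <= y <= d -> exists p k q,
     differentiable_pt_lim P x y p k /\ differentiable_pt_lim Q x y k q) ->
  RInt (fun x => P x c - P x d) a b + RInt (fun y => Q b y - Q a y) c d = 0.
Proof.
  intros Hab Hcd HPQ.
  assert (HiP : forall y y' x x', c <= y <= d -> c <= y' <= d -> a <= x -> x <= x' -> x' <= b ->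
    ex_RInt (fun u => P u y - P u y') x x').
  { intros y y' x x' Hy Hy' Hx Hxx Hx'. apply @ex_RInt_continuous. intros u Hu.
    rewrite Rmin_left, Rmax_right in Hu by lra.
    apply @continuous_minus.
    - destruct (HPQ u y) as (p & k & q & H & _); [lra|lra|].
      exact (differentiable_pt_lim_continuous_x _ _ _ _ _ H).
    - destruct (HPQ u y') as (p & k & q & H & _); [lra|lra|].
      exact (differentiable_pt_lim_continuous_x _ _ _ _ _ H). }
  assert (HiQ : forall x x' y y', a <= x <= b -> a <= x' <= b -> c <= y -> y <= y' -> y' <= d ->
    ex_RInt (fun v => Q x v - Q x' v) y y').
  { intros x x' y y' Hx Hx' Hy Hyy Hy'. apply @ex_RInt_continuous. intros v Hv.
    rewrite Rmin_left, Rmax_right in Hv by lra.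
    apply @continuous_minus.
    - destruct (HPQ x v) as (p & k & q & _ & H); [lra|lra|].
      exact (differentiable_pt_lim_continuous_y _ _ _ _ _ H).
    - destruct (HPQ x' v) as (p & k & q & _ & H); [lra|lra|].
      exact (differentiable_pt_lim_continuous_y _ _ _ _ _ H). }
  set (I := fun x x' y y' =>
    RInt (fun u => P u y - P u y') x x' + RInt (fun v => Q x' v - Q x v) y y').
  change (I a b c d = 0).
  assert (Hx3 : forall x m x' y y', a <= x -> x <= m -> m <= x' -> x' <= b ->
     c <= y -> y <= y' -> y' <= d -> I x x' y y' = I x m y y' + I m x' y y').
  { intros x m x' y y' H1 H2 H3 H4 H5 H6 H7. unfold I.
    rewrite <- (RInt_Chasles (fun u => P u y - P u y') x m x') by (apply HiP; lra).
    rewrite (RInt_ext (fun v => Q x' v - Q x v)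
       (fun v => (Q x' v - Q m v) + (Q m v - Q x v))).
    2:{ intros v _. Rring. }
    rewrite RInt_Rplus by (apply HiQ; lra). unfold plus; simpl. Rring. }
  assert (Hy3 : forall x x' y m y', a <= x -> x <= x' -> x' <= b ->
     c <= y -> y <= m -> m <= y' -> y' <= d -> I x x' y y' = I x x' y m + I x x' m y').
  { intros x x' y m y' H1 H2 H3 H4 H5 H6 H7. unfold I.
    rewrite <- (RInt_Chasles (fun v => Q x' v - Q x v) y m y') by (apply HiQ; lra).
    rewrite (RInt_ext (fun u => P u y - P u y')
       (fun u => (P u y - P u m) + (P u m - P u y'))).
    2:{ intros v _. Rring. }
    rewrite RInt_Rplus by (apply HiP; lra). unfold plus; simpl. Rring. }
  set (A := b - a). set (B := d - c).
  assert (HA : 0 < A) by (unfold A; lra). assert (HB : 0 < B) by (unfold B; lra).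
  apply NNPP; intros Hne.
  (* Chosen so that the bound for the whole rectangle, [2 e (A + B)^2], is half of [|I a b c d|]. *)
  set (e := Rabs (I a b c d) / (4 * (A + B) * (A + B))).
  assert (HI : 0 < Rabs (I a b c d)) by (apply Rabs_pos_lt; exact Hne).
  assert (He : 0 < e) by (unfold e; apply Rdiv_lt_0_compat; nra).
  assert (H : Rabs (I (a + A * 0) (a + A * (0 + 1)) (c + B * 0) (c + B * (0 + 1)))
     <= 2 * e * (A + B) * (A + B) * (1 * 1)).
  (* The bound is quadratic in [s], hence preserved by adding four quarters. *)
  { apply (square_induction (fun x y s =>
      Rabs (I (a + A * x) (a + A * (x + s)) (c + B * y) (c + B * (y + s)))
        <= 2 * e * (A + B) * (A + B) * (s * s))).
    - intros x y s Hs Hx Hxs Hy Hys H1 H2 H3 H4.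
      replace (x + s / 2 + s / 2) with (x + s) in * by field.
      replace (y + s / 2 + s / 2) with (y + s) in * by field.
      rewrite (Hx3 _ (a + A * (x + s / 2))); try (unfold A, B in *; nra).
      rewrite (Hy3 _ (a + A * (x + s / 2)) _ (c + B * (y + s / 2)));
        try (unfold A, B in *; nra).
      rewrite (Hy3 (a + A * (x + s / 2)) _ _ (c + B * (y + s / 2)));
        try (unfold A, B in *; nra).
      eapply Rle_trans; [apply Rabs_triang|].
      eapply Rle_trans; [apply Rplus_le_compat; apply Rabs_triang|].
      lra.
    - intros x y Hx Hy.
      destruct (HPQ (a + A * x) (c + B * y)) as (p & k & q & HP & HQ);
        [unfold A in *; nra|unfold B in *; nra|].
      destruct (HP (mkposreal _ He)) as [d1 Hd1]. destruct (HQ (mkposreal _ He)) as [d2 Hd2].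
      simpl in Hd1, Hd2.
      set (dd := Rmin d1 d2). assert (Hdd : 0 < dd) by (apply Rmin_pos; apply cond_pos).
      assert (Hdd1 : dd <= d1) by apply Rmin_l. assert (Hdd2 : dd <= d2) by apply Rmin_r.
      exists (dd / (A + B)). split; [apply Rdiv_lt_0_compat; lra|].
      intros x' y' s Hs Hx' Hxs Hy' Hys.
      assert (HS : s * (A + B) < dd).
      { replace dd with (dd / (A + B) * (A + B)) by (field; lra).
        apply Rmult_lt_compat_r; lra. }
      set (X := a + A * x) in *. set (Y := c + B * y) in *.
      assert (Hnear : forall u v, a + A * x' <= u <= a + A * (x' + s) ->
         c + B * y' <= v <= c + B * (y' + s) ->
         Rabs (P u v - P X Y - (p * (u - X) + k * (v - Y))) <= e * (s * (A + B)) /\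
         Rabs (Q u v - Q X Y - (k * (u - X) + q * (v - Y))) <= e * (s * (A + B))).
      { intros u v Hu Hv.
        assert (H1 : Rabs (u - X) <= s * (A + B)) by (apply Rabs_le; unfold X; nra).
        assert (H2 : Rabs (v - Y) <= s * (A + B)) by (apply Rabs_le; unfold Y; nra).
        assert (Hmx : Rmax (Rabs (u - X)) (Rabs (v - Y)) <= s * (A + B))
          by (apply Rmax_lub; assumption).
        split.
        - eapply Rle_trans; [apply Hd1; lra|]. apply Rmult_le_compat_l; lra.
        - eapply Rle_trans; [apply Hd2; lra|]. apply Rmult_le_compat_l; lra. }
      (* The linear parts contribute [- k A B s^2] here and [k A B s^2] in [E2], which cancel. The
         errors are [A s] and [B s] times [2 e s (A + B)], together [2 e (A + B)^2 s^2]. *)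
      assert (E1 : Rabs (RInt (fun u => P u (c + B * y') - P u (c + B * (y' + s)))
          (a + A * x') (a + A * (x' + s)) - - (k * (B * s)) * (a + A * (x' + s) - (a + A * x')))
          <= (a + A * (x' + s) - (a + A * x')) * (2 * e * (s * (A + B)))).
      { apply RInt_near_const; [nra|apply HiP; unfold A, B in *; nra|].
        intros u Hu. destruct (Hnear u (c + B * y')) as [N1 _]; [lra|nra|].
        destruct (Hnear u (c + B * (y' + s))) as [N2 _]; [lra|nra|].
        apply Rabs_le_between in N1. apply Rabs_le_between in N2. apply Rabs_le. lra. }
      assert (E2 : Rabs (RInt (fun v => Q (a + A * (x' + s)) v - Q (a + A * x') v)
          (c + B * y') (c + B * (y' + s)) - (k * (A * s)) * (c + B * (y' + s) - (c + B * y')))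
          <= (c + B * (y' + s) - (c + B * y')) * (2 * e * (s * (A + B)))).
      { apply RInt_near_const; [nra|apply HiQ; unfold A, B in *; nra|].
        intros v Hv. destruct (Hnear (a + A * x') v) as [_ N1]; [nra|lra|].
        destruct (Hnear (a + A * (x' + s)) v) as [_ N2]; [nra|lra|].
        apply Rabs_le_between in N1. apply Rabs_le_between in N2. apply Rabs_le. lra. }
      apply Rabs_le_between in E1. apply Rabs_le_between in E2.
      unfold I. apply Rabs_le. lra. }
  replace (a + A * 0) with a in H by ring. replace (c + B * 0) with c in H by ring.
  replace (a + A * (0 + 1)) with b in H by (unfold A; ring).
  replace (c + B * (0 + 1)) with d in H by (unfold B; ring).
  replace (2 * e * (A + B) * (A + B) * (1 * 1)) with (Rabs (I a b c d) / 2) in H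
    by (unfold e; field; lra).
  lra.
Qed.

Lemma is_derive_C (f : C -> C) (z l : C) :
  is_derive f z l <-> forall eps, 0 < eps -> exists d, 0 < d /\ forall w,
    Cmod (w - z) < d -> Cmod (f w - f z - l * (w - z)) <= eps * Cmod (w - z).
Proof.
  split.
  - intros [_ H] eps Heps. specialize (H z (fun P HP => HP) (mkposreal _ Heps)).
    apply locally_C, locally_Cmod in H. destruct H as [d [Hd H]].
    exists d. split; [exact Hd|]. intros w Hw. specialize (H w Hw).
    replace (f w - f z - l * (w - z))%C with (f w - f z - (w - z) * l)%C by ring.
    exact H.
  - intros H. split; [apply is_linear_scal_l|].
    intros x Hx. apply (is_filter_lim_locally_unique (V:=AbsRing_NormedModule C_AbsRing)) in Hx.
    subst x. intros eps. apply locally_C, locally_Cmod.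
    destruct (H eps (cond_pos eps)) as [d [Hd H']]. exists d. split; [exact Hd|].
    intros w Hw. specialize (H' w Hw).
    replace (f w - f z - l * (w - z))%C with (f w - f z - (w - z) * l)%C in H' by ring.
    exact H'.
Qed.

Lemma is_derive_C_cauchy_riemann (f : C -> C) (x y : R) (l : C) :
  is_derive (f : C_AbsRing -> C_NormedModule) ((x, y) : C) l ->
  differentiable_pt_lim (fun u v => Re (f (u, v))) x y (Re l) (- Im l) /\
  differentiable_pt_lim (fun u v => Im (f (u, v))) x y (Im l) (Re l).
Proof.
  intros H.
  assert (Hd := proj1 (is_derive_C f (x, y) l) H).
  assert (Haux : forall eps : posreal, locally_2d (fun u v =>
    Cmod (f (u, v) - f (x, y) - l * ((u, v) - (x, y)))%C <=
      eps * Rmax (Rabs (u - x)) (Rabs (v - y))) x y).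
  { intros eps. assert (He : 0 < eps / 2) by (generalize (cond_pos eps); lra).
    destruct (Hd _ He) as [d [Hd0 Hd']].
    assert (Hd2 : 0 < d / 2) by lra. exists (mkposreal _ Hd2). simpl.
    intros u v Hu Hv.
    assert (Hc : Cmod ((u, v) - (x, y))%C <= Rabs (u - x) + Rabs (v - y))
      by exact (Cmod_le_abs ((u, v) - (x, y))%C).
    eapply Rle_trans; [apply Hd'; lra|].
    generalize (Rmax_l (Rabs (u - x)) (Rabs (v - y))) (Rmax_r (Rabs (u - x)) (Rabs (v - y))).
    intros. nra. }
  split; intros eps; destruct (Haux eps) as [d Hd']; exists d; intros u v Hu Hv;
    (eapply Rle_trans; [|apply Hd'; assumption]);
    set (zz := (f (u, v) - f (x, y) - l * ((u, v) - (x, y)))%C);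
    (eapply Rle_trans; [|apply (Rmax_Cmod zz)]).
  - eapply Rle_trans; [|apply Rmax_l]. right. f_equal. unfold zz, Re, Im; simpl. ring.
  - eapply Rle_trans; [|apply Rmax_r]. right. f_equal. unfold zz, Re, Im; simpl. ring.
Qed.

Lemma differentiable_pt_lim_mult (x y : R) :
  differentiable_pt_lim Rmult x y y x.
Proof.
  intros eps. exists eps. intros u v Hu Hv.
  replace (u * v - x * y - (y * (u - x) + x * (v - y))) with ((u - x) * (v - y)) by ring.
  rewrite Rabs_mult. generalize (Rabs_pos (u - x)) (Rabs_pos (v - y))
   (Rmax_l (Rabs (u - x)) (Rabs (v - y))) (Rmax_r (Rabs (u - x)) (Rabs (v - y))).
  intros. apply Rmult_le_compat; lra.
Qed.

Lemma differentiable_pt_lim_proj2 (f : R -> R) (x y l : R) :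
  derivable_pt_lim f y l -> differentiable_pt_lim (fun _ v => f v) x y 0 l.
Proof.
  intros H eps. destruct (differentiable_pt_lim_proj1_0 f y x l H eps) as [d Hd].
  exists d. intros u v Hu Hv. specialize (Hd v u Hv Hu).
  rewrite Rmax_comm. replace (0 * (u - x) + l * (v - y)) with (l * (v - y) + 0 * (u - x)) by ring.
  exact Hd.
Qed.

Lemma differentiable_pt_lim_prod (g h : R -> R) (x y g' h' : R) :
  derivable_pt_lim g x g' -> derivable_pt_lim h y h' ->
  differentiable_pt_lim (fun u v => g u * h v) x y (h y * g') (g x * h').
Proof.
  intros Hg Hh.
  replace (h y * g') with (h y * g' + g x * 0) by ring.
  replace (g x * h') with (h y * 0 + g x * h') by ring.
  apply (differentiable_pt_lim_comp Rmult (fun u _ => g u) (fun _ v => h v)).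
  - apply differentiable_pt_lim_mult.
  - apply differentiable_pt_lim_proj1_0, Hg.
  - apply differentiable_pt_lim_proj2, Hh.
Qed.

Definition polar (r t : R) : C := (r * cos t, r * sin t).

Lemma Cmod_polar (r t : R) : 0 <= r -> Cmod (polar r t) = r.
Proof.
  intros Hr. unfold Cmod, polar; simpl.
  replace (r * cos t * (r * cos t * 1) + r * sin t * (r * sin t * 1)) with (r ^ 2).
  - apply sqrt_pow2, Hr.
  - generalize (sin2_cos2 t). unfold Rsqr. intros H.
    replace (r * cos t * (r * cos t * 1) + r * sin t * (r * sin t * 1))
      with (r ^ 2 * (sin t * sin t + cos t * cos t)) by ring.
    rewrite H. ring.
Qed.

(** The Cauchy-Riemann equations survive composition with the holomorphic map [exp (s + i t)]. The
    common [k], the [s]-derivative of the real part and the [t]-derivative of the imaginary part, is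
    the closedness required by [goursat_rectangle]. *)
Lemma ex_derive_polar (f : C -> C) (s t : R) :
  ex_derive (f : C_AbsRing -> C_NormedModule) (polar (exp s) t) ->
  exists p k q,
   differentiable_pt_lim (fun s t => Im (f (polar (exp s) t))) s t p k /\
   differentiable_pt_lim (fun s t => Re (f (polar (exp s) t))) s t k q.
Proof.
  intros [l Hl]. apply is_derive_C_cauchy_riemann in Hl. destruct Hl as [HU HV].
  assert (Hc : differentiable_pt_lim (fun s t => exp s * cos t) s t
     (cos t * exp s) (exp s * - sin t)).
  { apply differentiable_pt_lim_prod; [apply derivable_pt_lim_exp|apply derivable_pt_lim_cos]. }
  assert (Hs : differentiable_pt_lim (fun s t => exp s * sin t) s t
     (sin t * exp s) (exp s * cos t)).
  { apply differentiable_pt_lim_prod; [apply derivable_pt_lim_exp|apply derivable_pt_lim_sin]. }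
  generalize (differentiable_pt_lim_comp _ _ _ _ _ _ _ _ _ _ _ HU Hc Hs).
  generalize (differentiable_pt_lim_comp _ _ _ _ _ _ _ _ _ _ _ HV Hc Hs).
  intros H1 H2. eexists; eexists; eexists. split; [exact H1|].
  replace (Im l * (exp s * - sin t) + Re l * (exp s * cos t)) with
   (Re l * (cos t * exp s) + - Im l * (sin t * exp s)) by ring. exact H2.
Qed.

Lemma continuous_polar (f : C -> C) (r t : R) : 0 < r ->
  ex_derive (f : C_AbsRing -> C_NormedModule) (polar r t) ->
  continuous (fun t => Re (f (polar r t))) t.
Proof.
  intros Hr H. rewrite <- (exp_ln r Hr) in H |- *.
  destruct (ex_derive_polar f _ _ H) as (p & k & q & _ & H2).
  rewrite exp_ln in * by exact Hr.
  generalize (differentiable_pt_lim_continuous_y _ _ _ _ _ H2). simpl.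
  rewrite exp_ln by exact Hr. auto.
Qed.

(* In logarithmic coordinates [z = exp (s + i t)] the form
   [Re f dt + Im f ds] is closed, so the circular means of [Re f] are constant;
   the singularity at [0] only has to be continuous. *)
Lemma mean_value_property (f : C -> C) (R0 r : R) :
  (forall z : C, 0 < Cmod z < R0 -> ex_derive f z) ->
  (forall eps, 0 < eps -> exists d, 0 < d /\ forall z, Cmod z < d -> Cmod (f z - f 0) <= eps) ->
  0 < r < R0 ->
  RInt (fun t => Re (f (polar r t))) (- PI) PI = 2 * PI * Re (f 0).
Proof.
  intros Hf Hc Hr. generalize PI_RGT_0; intros HPI.
  assert (Hint : forall r, 0 < r < R0 -> ex_RInt (fun t => Re (f (polar r t))) (- PI) PI).
  { intros r' Hr'. apply @ex_RInt_continuous. intros t _.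
    apply continuous_polar; [lra|]. apply Hf. rewrite Cmod_polar; lra. }
  assert (Hconst : forall r', 0 < r' < r -> RInt (fun t => Re (f (polar r t))) (- PI) PI =
     RInt (fun t => Re (f (polar r' t))) (- PI) PI).
  { intros r' Hr'.
    assert (Hln : ln r' < ln r) by (apply ln_increasing; lra).
    assert (G := goursat_rectangle (fun s t => Im (f (polar (exp s) t)))
      (fun s t => Re (f (polar (exp s) t))) (ln r') (ln r) (- PI) PI Hln).
    cbv beta in G. rewrite !exp_ln in G by lra.
    (* The sides [t = - PI] and [t = PI] are the same segment of the negative axis, so their
       contributions cancel. *)
    rewrite (RInt_ext (fun x => Im (f (polar (exp x) (- PI))) - Im (f (polar (exp x) PI)))
       (fun _ => 0)) in G.
    2:{ intros x _. unfold polar. rewrite cos_neg, sin_neg, sin_PI.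
        replace (- 0) with 0 by ring. Rring. }
    rewrite RInt_Rconst, (RInt_Rminus (fun t => Re (f (polar r t)))) in G
      by (apply Hint; lra).
    rewrite Rmult_0_r, Rplus_0_l in G. apply Rminus_diag_uniq. apply G; [lra|].
    intros s t Hs Ht. apply ex_derive_polar. apply Hf.
    generalize (exp_pos s); intros Hp. rewrite Cmod_polar by lra. split; [exact Hp|].
    apply Rle_lt_trans with r; [|lra]. rewrite <- (exp_ln r) by lra.
    destruct (Rle_lt_or_eq_dec s (ln r)) as [H|H]; [lra| |].
    - left; apply exp_increasing, H.
    - right; rewrite H; reflexivity. }
  apply Rminus_diag_uniq. apply NNPP; intros Hne. apply Rabs_pos_lt in Hne.
  set (D := Rabs (RInt (fun t => Re (f (polar r t))) (- PI) PI - 2 * PI * Re (f 0))) in *.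
  (* Over an interval of length [2 PI] this error adds up to [D / 2], less than the supposed
     discrepancy [D]. *)
  destruct (Hc (D / (4 * PI))) as [d [Hd Hd']]; [apply Rdiv_lt_0_compat; lra|].
  set (r' := Rmin (d / 2) (r / 2)).
  assert (H1 : 0 < r') by (apply Rmin_pos; lra).
  assert (H2 : r' <= d / 2) by apply Rmin_l. assert (H3 : r' <= r / 2) by apply Rmin_r.
  assert (HN : Rabs (RInt (fun t => Re (f (polar r' t))) (- PI) PI - Re (f 0) * (PI - - PI))
    <= (PI - - PI) * (D / (4 * PI))).
  { apply RInt_near_const; [lra|apply Hint; lra|]. intros t _.
    eapply Rle_trans; [|apply (Hd' (polar r' t)); rewrite Cmod_polar; lra].
    replace (Re (f (polar r' t)) - Re (f 0)) with (Re (f (polar r' t) - f 0)%C)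
      by (unfold Re; simpl; ring). apply re_le_Cmod. }
  rewrite <- (Hconst r') in HN by lra.
  replace (Re (f 0) * (PI - - PI)) with (2 * PI * Re (f 0)) in HN by ring.
  fold D in HN. replace ((PI - - PI) * (D / (4 * PI))) with (D / 2) in HN by (field; lra).
  lra.
Qed.

(* Coquelicot has two normed structures on [C]; its product and chain rules use the other one. *)
Lemma is_derive_C_ring (f : C -> C) (z l : C) :
  is_derive (V := AbsRing_NormedModule C_AbsRing) f z l <->
  is_derive (V := C_NormedModule) f z l.
Proof.
  split; intros [_ H]; (split; [apply is_linear_scal_l|exact H]).
Qed.

(** * Calculus of complex derivatives *)

Lemma ex_derive_C_plus (f g : C -> C) (z : C) :
  ex_derive f z -> ex_derive g z -> ex_derive (fun w => f w + g w)%C z.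
Proof. intros Hf Hg. exact (ex_derive_plus f g z Hf Hg). Qed.

Lemma ex_derive_C_minus (f g : C -> C) (z : C) :
  ex_derive f z -> ex_derive g z -> ex_derive (fun w => f w - g w)%C z.
Proof. intros Hf Hg. exact (ex_derive_minus f g z Hf Hg). Qed.

Lemma ex_derive_C_mult (f g : C -> C) (z : C) :
  ex_derive f z -> ex_derive g z -> ex_derive (fun w => f w * g w)%C z.
Proof.
  intros [l Hl] [m Hm]. eexists.
  apply is_derive_C_ring in Hl, Hm. apply is_derive_C_ring.
  exact (is_derive_mult (K := C_AbsRing) f g z l m Hl Hm Cmult_comm).
Qed.

Lemma ex_derive_C_const (c z : C) : ex_derive (fun _ : C => c) z.
Proof. exact (ex_derive_const (K := C_AbsRing) (V := C_NormedModule) c z). Qed.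

Lemma ex_derive_C_id (z : C) : ex_derive (fun w : C => w) z.
Proof. exists (RtoC 1). apply is_derive_C_ring. exact (is_derive_id (K := C_AbsRing) z). Qed.

Lemma is_derive_C_comp (f g : C -> C) (z l m : C) :
  is_derive f (g z) l -> is_derive g z m -> is_derive (fun w => f (g w)) z (m * l)%C.
Proof.
  intros Hf Hg. apply is_derive_C_ring in Hg.
  exact (is_derive_comp (K := C_AbsRing) (V := C_NormedModule) f g z l m Hf Hg).
Qed.

Lemma ex_derive_C_comp (f g : C -> C) (z : C) :
  ex_derive f (g z) -> ex_derive g z -> ex_derive (fun w => f (g w)) z.
Proof. intros [l Hl] [m Hm]. eexists. exact (is_derive_C_comp f g z l m Hl Hm). Qed.

Lemma is_derive_C_affine (a b z : C) : is_derive (fun w : C => a + b * w)%C z b.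
Proof.
  apply is_derive_C. intros eps Heps. exists 1. split; [lra|]. intros w _.
  replace (a + b * w - (a + b * z) - b * (w - z))%C with (RtoC 0) by ring.
  rewrite Cmod_0. apply Rmult_le_pos; [lra|apply Cmod_ge_0].
Qed.

Lemma ex_derive_C_ext_loc (f g : C -> C) (z : C) :
  (exists d, 0 < d /\ forall w, Cmod (w - z) < d -> f w = g w) ->
  ex_derive f z -> ex_derive g z.
Proof.
  intros H. apply (ex_derive_ext_loc (K := C_AbsRing) (V := C_NormedModule)).
  apply locally_C, locally_Cmod, H.
Qed.

Lemma ex_derive_C_continuous (f : C -> C) (z : C) :
  ex_derive f z -> forall eps, 0 < eps -> exists d, 0 < d /\ forall w,
    Cmod (w - z) < d -> Cmod (f w - f z) < eps.
Proof.
  intros [l Hl] eps Heps. generalize (Cmod_ge_0 l); intros Hl0.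
  destruct (proj1 (is_derive_C f z l) Hl 1 Rlt_0_1) as [d [Hd H]].
  exists (Rmin d (eps / (Cmod l + 2))).
  assert (Hq : 0 < eps / (Cmod l + 2)) by (apply Rdiv_lt_0_compat; lra).
  split; [apply Rmin_pos; lra|]. intros w Hw.
  assert (Hw1 := Rlt_le_trans _ _ _ Hw (Rmin_l _ _)).
  assert (Hw2 := Rlt_le_trans _ _ _ Hw (Rmin_r _ _)).
  replace (f w - f z)%C with ((f w - f z - l * (w - z)) + l * (w - z))%C by ring.
  apply Rle_lt_trans with (1 := Cmod_triangle _ _). rewrite Cmod_mult.
  specialize (H w Hw1). generalize (Cmod_ge_0 (w - z)%C); intros.
  replace eps with (eps / (Cmod l + 2) * (Cmod l + 2)) by (field; lra).
  nra.
Qed.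

Lemma ex_derive_C_inv (z : C) : z <> 0%C -> ex_derive (fun w : C => / w)%C z.
Proof.
  intros Hz. exists (- / (z * z))%C. apply is_derive_C. intros eps Heps.
  assert (Hm : 0 < Cmod z) by (apply Cmod_gt_0, Hz).
  set (m := Cmod z) in *.
  (* The first bound keeps [|w| > m / 2]. The remainder is [(w - z)^2 / (z^2 w)], so
     [|w - z| <= eps m^2 |w|] is needed, which the second bound then provides. *)
  exists (Rmin (m / 2) (eps * m * m * m / 2)). split.
  { apply Rmin_pos; [lra|]. assert (0 < eps * m) by nra. assert (0 < eps * m * m) by nra. nra. }
  intros w Hw.
  assert (Hw1 := Rlt_le_trans _ _ _ Hw (Rmin_l _ _)).
  assert (Hw2 := Rlt_le_trans _ _ _ Hw (Rmin_r _ _)).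
  assert (Hwm : m / 2 < Cmod w).
  { generalize (Cmod_triangle (z - w) w). replace (z - w + w)%C with z by ring.
    rewrite Cmod_sub_sym. fold m. lra. }
  assert (Hw0 : w <> 0%C).
  { intros E. rewrite E, Cmod_0 in Hwm. lra. }
  replace (/ w - / z - - / (z * z) * (w - z))%C with ((w - z) * (w - z) * / (z * z * w))%C
    by (field; auto).
  rewrite !Cmod_mult, Cmod_inv, !Cmod_mult by (repeat apply Cmult_neq_0; auto).
  fold m. generalize (Cmod_ge_0 (w - z)%C); intros Hge.
  rewrite Rmult_assoc, (Rmult_comm eps). apply Rmult_le_compat_l; [exact Hge|].
  apply Rmult_le_reg_r with (m * m * Cmod w); [assert (0 < m * m) by nra; nra|].
  rewrite Rmult_assoc, Rinv_l, Rmult_1_r by (assert (0 < m * m) by nra; nra).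
  assert (0 < eps * m * m) by (assert (0 < eps * m) by nra; nra). nra.
Qed.

(** * The maximum modulus principle *)

Lemma re_mult_le (a b : C) : Re (a * b) <= Cmod a * Cmod b.
Proof.
  rewrite <- Cmod_mult. eapply Rle_trans; [apply Rle_abs|apply re_le_Cmod].
Qed.

Lemma re_conj_mult (a : C) : Re (Cconj a * a) = Cmod a * Cmod a.
Proof.
  destruct a as [x y]. generalize (Cmod2_alt (x, y)). unfold Re, Im; simpl. intros E.
  replace (Cmod (x, y) * Cmod (x, y)) with (Cmod (x, y) * (Cmod (x, y) * 1)) by ring.
  rewrite E. ring.
Qed.

Lemma ex_RInt_polar (f : C -> C) (R0 r : R) :
  (forall z : C, 0 < Cmod z < R0 -> ex_derive f z) -> 0 < r < R0 ->
  ex_RInt (fun t => Re (f (polar r t))) (- PI) PI.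
Proof.
  intros Hf Hr. apply @ex_RInt_continuous. intros t _.
  apply continuous_polar; [lra|]. apply Hf. rewrite Cmod_polar; lra.
Qed.

(* At an interior maximum of [Re (c g z) + eps |z|^2] the circular mean of the
   harmonic part would be too small. *)
Lemma maximum_modulus (g : C -> C) (M : R) :
  continuous_on closed_disk g ->
  (forall z : C, disk z -> ex_derive g z) ->
  (forall z, Cmod z = 1 -> Cmod (g z) <= M) ->
  forall z, closed_disk z -> Cmod (g z) <= M.
Proof.
  intros Hc Hd HM z1 Hz1. apply Rnot_lt_le; intros Hlt.
  assert (HM0 : 0 <= M) by (eapply Rle_trans; [apply Cmod_ge_0|apply (HM 1%C), Cmod_1]).
  set (m := Cmod (g z1)) in *. set (c := Cconj (g z1)).
  assert (Hcm : Cmod c = m) by apply Cmod_conj.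
  (* At [z1] the function [h] below is at least [m^2], on the unit circle at most [m M + eps]. This
     [eps] is half the gap [m^2 - m M], which forces the maximum of [h] into the interior. *)
  set (eps := m * (m - M) / 2). assert (Heps : 0 < eps) by (unfold eps; nra).
  set (h := fun z => Re (c * g z) + eps * (Cmod z * Cmod z)).
  assert (Hhc : continuous_on closed_disk h).
  { apply continuous_on_R. intros z Hz e He.
    destruct (proj1 (continuous_on_C closed_disk g) Hc z Hz (e / (2 * m)))
      as [d [Hd0 H]]; [apply Rdiv_lt_0_compat; lra|].
    exists (Rmin d (e / (4 * eps))).
    assert (Hq : 0 < e / (4 * eps)) by (apply Rdiv_lt_0_compat; lra).
    split; [apply Rmin_pos; lra|]. intros w Hw Hwz.
    assert (Hw1 := Rlt_le_trans _ _ _ Hwz (Rmin_l _ _)).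
    assert (Hw2 := Rlt_le_trans _ _ _ Hwz (Rmin_r _ _)).
    specialize (H w Hw Hw1). unfold h.
    replace (Re (c * g w) + eps * (Cmod w * Cmod w) - (Re (c * g z) + eps * (Cmod z * Cmod z)))
      with (Re (c * (g w - g z)) + eps * ((Cmod w - Cmod z) * (Cmod w + Cmod z)))
      by (rewrite !re_mult; unfold Re, Im; simpl; ring).
    apply Rle_lt_trans with (1 := Rabs_triang _ _).
    assert (H1 : Rabs (Re (c * (g w - g z))) < e / 2).
    { apply Rle_lt_trans with (1 := re_le_Cmod _). rewrite Cmod_mult, Hcm.
      replace (e / 2) with (m * (e / (2 * m))) by (field; lra).
      apply Rmult_lt_compat_l; lra. }
    assert (H2 : Rabs (Cmod w - Cmod z) <= Cmod (w - z)).
    { generalize (Cmod_triangle (w - z) z) (Cmod_triangle (z - w) w).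
      replace (w - z + z)%C with w by ring. replace (z - w + w)%C with z by ring.
      rewrite (Cmod_sub_sym z w). intros. apply Rabs_le; lra. }
    rewrite Rabs_mult, (Rabs_pos_eq eps) by lra. rewrite Rabs_mult.
    generalize (Cmod_ge_0 w) (Cmod_ge_0 z) (Rabs_pos (Cmod w - Cmod z)). intros.
    rewrite (Rabs_pos_eq (Cmod w + Cmod z)) by lra. unfold closed_disk in *.
    assert (Rabs (Cmod w - Cmod z) * (Cmod w + Cmod z) <= e / (4 * eps) * 2) by nra.
    assert (eps * (Rabs (Cmod w - Cmod z) * (Cmod w + Cmod z)) <= eps * (e / (4 * eps) * 2))
      by (apply Rmult_le_compat_l; lra).
    replace (eps * (e / (4 * eps) * 2)) with (e / 2) in * by (field; lra). lra. }
  destruct (closed_disk_max h Hhc) as [z0 [Hz0 Hmax]].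
  assert (H1 : m * m <= h z0).
  { eapply Rle_trans; [|apply (Hmax z1 Hz1)]. unfold h, c. rewrite re_conj_mult. fold m.
    generalize (Cmod_ge_0 z1). nra. }
  destruct (Rle_lt_or_eq_dec _ _ Hz0) as [Hin|Hon].
  (* Since [|z0 + w|^2 = |z0|^2 + |w|^2 + 2 Re (conj z0 w)], the linear term makes [h (z0 + w)]
     equal to [Re (f w)] plus a constant on each circle. Maximality then gives
     [Re (f w) <= Re (f 0) - eps r^2], against the mean value property. *)
  - set (f := fun w : C => (c * g (z0 + 1 * w) + 2 * eps * Cconj z0 * w)%C).
    set (r := (1 - Cmod z0) / 2).
    assert (Hfd : forall z : C, Cmod z < 1 - Cmod z0 -> ex_derive f z).
    { intros z Hz. unfold f. apply ex_derive_C_plus.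
      - apply ex_derive_C_mult; [apply ex_derive_C_const|].
        apply (ex_derive_C_comp g (fun w => z0 + 1 * w)%C).
        + apply Hd. unfold disk. eapply Rle_lt_trans; [apply Cmod_triangle|].
          rewrite Cmult_1_l. lra.
        + eexists; apply is_derive_C_affine.
      - apply ex_derive_C_mult; [apply ex_derive_C_const|apply ex_derive_C_id]. }
    assert (Hmv := mean_value_property f (1 - Cmod z0) r).
    assert (Hr : 0 < r < 1 - Cmod z0) by (unfold r; lra).
    assert (E : RInt (fun t => Re (f (polar r t))) (- PI) PI = 2 * PI * Re (f 0)).
    { apply Hmv; [intros z Hz; apply Hfd; lra| |exact Hr].
      intros e He. destruct (ex_derive_C_continuous f 0) with (eps := e) as [d [Hd0 H]];
        [apply Hfd; rewrite Cmod_0; lra|exact He|].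
      exists d; split; [exact Hd0|]. intros z Hz. left. apply H.
      replace (z - 0)%C with z by ring. exact Hz. }
    generalize PI_RGT_0; intros HPI.
    assert (Hle : RInt (fun t => Re (f (polar r t))) (- PI) PI <=
       RInt (fun _ => Re (c * g z0) - eps * (r * r)) (- PI) PI).
    { apply RInt_le; [lra| |apply @ex_RInt_const|].
      - apply (ex_RInt_polar f (1 - Cmod z0)); [intros; apply Hfd; lra|exact Hr].
      - intros t _. set (w := polar r t).
        assert (Hw : Cmod w = r) by (apply Cmod_polar; lra).
        assert (Hcd : closed_disk (z0 + w)%C).
        { unfold closed_disk. eapply Rle_trans; [apply Cmod_triangle|]. rewrite Hw; lra. }
        specialize (Hmax _ Hcd). unfold h in Hmax. unfold f. rewrite Cmult_1_l.
        replace (Cmod (z0 + w) * Cmod (z0 + w)) with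
          (Cmod z0 * Cmod z0 + r * r + 2 * Re (Cconj z0 * w)%C) in Hmax.
        + replace (Re (c * g (z0 + w) + 2 * eps * Cconj z0 * w)%C) with
            (Re (c * g (z0 + w))%C + 2 * eps * Re (Cconj z0 * w)%C).
          * lra.
          * destruct (c * g (z0 + w))%C, (Cconj z0), w. unfold Re; simpl. ring.
        + rewrite <- Hw, <- !re_conj_mult. destruct z0, w. unfold Re; simpl. ring. }
    rewrite RInt_Rconst, E in Hle.
    replace (Re (f 0)) with (Re (c * g z0)) in Hle.
    + assert (0 < eps * (r * r)) by (apply Rmult_lt_0_compat; nra). nra.
    + unfold f. f_equal. replace (z0 + 1 * 0)%C with z0 by ring. ring.
  - assert (Re (c * g z0) <= m * M).
    { eapply Rle_trans; [apply re_mult_le|]. rewrite Hcm. apply Rmult_le_compat_l; [lra|].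
      apply HM, Hon. }
    unfold h in H1. rewrite Hon in H1. unfold eps in H1. nra.
Qed.

(** * Derivative bounds from angular differences *)

Lemma polar_exists (z : C) : exists t, z = polar (Cmod z) t.
Proof.
  destruct (Req_dec (Cmod z) 0) as [E|E].
  - exists 0. rewrite E. apply Cmod_eq_0 in E. rewrite E. unfold polar, RtoC.
    f_equal; ring.
  - assert (Hp : 0 < Cmod z) by (generalize (Cmod_ge_0 z); lra).
    destruct z as [x y]. set (m := Cmod (x, y)) in *.
    assert (H2 : m * m = x * x + y * y).
    { generalize (Cmod2_alt (x, y)). fold m. unfold Re, Im; simpl. lra. }
    assert (Hx : -1 <= x / m <= 1).
    { split; [apply Rmult_le_reg_r with m|apply Rmult_le_reg_r with m]; try assumption;
      replace (x / m * m) with x by (field; lra); nra. }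
    assert (Hs : sin (acos (x / m)) = Rabs y / m).
    { rewrite sin_acos by exact Hx.
      replace (1 - (x / m)²) with ((Rabs y / m)²).
      - apply sqrt_Rsqr. apply Rdiv_le_0_compat; [apply Rabs_pos|lra].
      - unfold Rsqr, Rdiv. replace (Rabs y * / m * (Rabs y * / m)) with
          (Rabs y * Rabs y * / m * / m) by ring.
        replace (Rabs y * Rabs y) with (y * y)
          by (rewrite <- Rabs_mult, Rabs_pos_eq; [reflexivity|nra]).
        replace (y * y) with (m * m - x * x) by lra. field. lra. }
    destruct (Rle_dec 0 y) as [Hy|Hy].
    + exists (acos (x / m)). unfold polar. rewrite Hs, cos_acos by exact Hx.
      rewrite Rabs_pos_eq by lra. f_equal; field; lra.
    + exists (- acos (x / m)). unfold polar. rewrite cos_neg, sin_neg, Hs, cos_acos by exact Hx.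
      rewrite Rabs_left by lra. f_equal; field; lra.
Qed.

Lemma Rabs_atan_le (x : R) : Rabs (atan x) <= Rabs x.
Proof.
  destruct (MVT_gen atan 0 x (fun t => / (1 + t ^ 2))) as [t [_ H]].
  - intros u _. apply is_derive_Reals, derivable_pt_lim_atan.
  - intros u _. apply derivable_continuous_pt. exists (/ (1 + u ^ 2)).
    apply derivable_pt_lim_atan.
  - rewrite atan_0, !Rminus_0_r in H. rewrite H, Rabs_mult.
    assert (Ht : 1 <= 1 + t ^ 2) by nra.
    rewrite (Rabs_pos_eq (/ _)) by (left; apply Rinv_0_lt_compat; lra).
    rewrite <- (Rmult_1_l (Rabs x)) at 2. apply Rmult_le_compat_r; [apply Rabs_pos|].
    rewrite <- Rinv_1. apply Rinv_le_contravar; lra.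
Qed.

Lemma polar_mult (r s t u : R) : (polar r s * polar t u)%C = polar (r * t) (s + u).
Proof.
  unfold polar, Cmult; simpl. rewrite cos_plus, sin_plus. f_equal; ring.
Qed.

(** The angle is twice the argument [atan (y / x)]. Its explicit bound decides which mirror pairs
    are covered by a hypothesis on small rotations. *)
Lemma rotation_of_conj (x y : R) : 0 < x ->
  exists a, Rabs a <= 2 * Rabs (y / x) /\ ((x, y) : C) = (polar 1 a * (x, (- y)%R))%C.
Proof.
  intros Hx. set (t := y / x). set (b := atan t). exists (2 * b). split.
  - rewrite Rabs_mult, (Rabs_pos_eq 2) by lra. apply Rmult_le_compat_l; [lra|].
    apply Rabs_atan_le.
  - assert (Hb : 0 < cos b) by (apply cos_gt_0; generalize (atan_bound t); unfold b; lra).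
    assert (Hs : sin b = t * cos b).
    { rewrite <- (tan_atan t). fold b. unfold tan. field. lra. }
    assert (H1 : (1 + t * t) * (cos b * cos b) = 1).
    { generalize (sin2_cos2 b). unfold Rsqr. rewrite Hs. lra. }
    assert (Hy : y = t * x) by (unfold t; field; lra).
    unfold polar, Cmult; simpl. rewrite cos_2a, sin_2a, Hs, Hy. f_equal.
    + replace (1 * (cos b * cos b - t * cos b * (t * cos b)) * x -
        1 * (2 * (t * cos b) * cos b) * - (t * x)) with (((1 + t * t) * (cos b * cos b)) * x) by ring.
      rewrite H1. ring.
    + replace (1 * (cos b * cos b - t * cos b * (t * cos b)) * - (t * x) +
        1 * (2 * (t * cos b) * cos b) * x) with (((1 + t * t) * (cos b * cos b)) * (t * x)) by ring.
      rewrite H1. ring.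
Qed.

(** Lets the integrand be estimated at [t] and [- t] together, where cancellation occurs. *)
Lemma RInt_even_part (k : R -> R) (a : R) : 0 <= a -> ex_RInt k (- a) a ->
  ex_RInt (fun t => k t + k (- t)) (- a) a /\
  RInt (fun t => k t + k (- t)) (- a) a = 2 * RInt k (- a) a.
Proof.
  intros Ha Hk.
  assert (Hi : is_RInt (fun t => k (- t)) (- a) a (RInt k (- a) a)).
  { assert (H := is_RInt_swap k _ _ _ (RInt_correct k _ _ Hk)).
    replace a with (- (- a)) in H at 1 by ring.
    assert (H' := is_RInt_comp_opp k (- a) a _ H).
    assert (H2 := is_RInt_opp _ _ _ _ H').
    rewrite opp_opp in H2. eapply is_RInt_ext; [|exact H2].
    intros t _. simpl. rewrite opp_opp. reflexivity. }
  assert (Hex : ex_RInt (fun t => k (- t)) (- a) a) by (eexists; exact Hi).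
  split.
  - exact (ex_RInt_plus k (fun t => k (- t)) _ _ Hk Hex).
  - rewrite (RInt_Rplus k (fun t => k (- t))) by assumption.
    rewrite (is_RInt_unique _ _ _ _ Hi). Rring.
Qed.

(* Cauchy's formula [f'(r) = (1/2 pi) int (f(r+z) - f r) (1/z - z/p^2)] over
   [|z| = p]: the kernel changes sign under conjugation, and [r + z] and its
   conjugate have the same modulus, so only angular differences of [F] enter. *)
Lemma derive_bound_on_radius (F : C -> C) (r B : R) (l : C) :
  3 / 4 <= r < 1 ->
  (forall z : C, disk z -> ex_derive F z) ->
  (forall z a, disk z -> Rabs a < 1 - r -> Cmod (F (polar 1 a * z)%C - F z) <= B) ->
  is_derive F (RtoC r) l ->
  Cmod l <= 8 * B / (1 - r).
Proof.
  (* With [r >= 3/4] this radius keeps the abscissa on the circle above [1/2], so mirror points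
     differ by a rotation of at most [4 p = (1 - r) / 2], within the range of [HB]. The final bound
     [B / p] is the source of the [8]. *)
  intros Hr Hd HB Hl. set (p := (1 - r) / 8). assert (Hp : 0 < p) by (unfold p; lra).
  generalize PI_RGT_0; intros HPI.
  (* Multiplying by the conjugate makes the mean real, [Re (c l) = |l|^2], so the mean value
     property for real parts is enough. *)
  set (c := Cconj l). assert (Hcm : Cmod c = Cmod l) by apply Cmod_conj.
  set (W := fun z : C => (/ z - z * (/ RtoC p * / RtoC p))%C).
  (* The value at [0] fills the removable singularity: the increment of [F] times [/ z] tends to
     [l], and times [z / p^2] to zero. *)
  set (f := fun z : C => if Ceq_dec z 0 then (c * l)%C else
     (c * (F (r + 1 * z) - F r) * W z)%C).
  assert (Hp0 : RtoC p <> 0%C) by (intros E; apply RtoC_inj in E; lra).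
  assert (Hdisk : forall z, Cmod z < 1 - r -> disk (r + 1 * z)%C).
  { intros z Hz. unfold disk. eapply Rle_lt_trans; [apply Cmod_triangle|].
    rewrite Cmult_1_l, Cmod_R, Rabs_pos_eq; lra. }
  assert (Hfd : forall z : C, 0 < Cmod z < 1 - r -> ex_derive f z).
  { intros z Hz.
    apply (ex_derive_C_ext_loc (fun z : C => (c * (F (r + 1 * z) - F r) * W z)%C)).
    - exists (Cmod z). split; [lra|]. intros w Hw. unfold f.
      destruct (Ceq_dec w 0) as [E|E]; [|reflexivity]. exfalso. rewrite E in Hw.
      replace (0 - z)%C with (- z)%C in Hw by ring. rewrite Cmod_opp in Hw. lra.
    - apply ex_derive_C_mult; [apply ex_derive_C_mult|]; [apply ex_derive_C_const| |].
      + apply ex_derive_C_minus; [|apply ex_derive_C_const].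
        apply (ex_derive_C_comp F (fun w => r + 1 * w)%C).
        * apply Hd, Hdisk; lra.
        * eexists; apply is_derive_C_affine.
      + apply ex_derive_C_minus.
        * apply ex_derive_C_inv, Cmod_gt_0, Hz.
        * apply ex_derive_C_mult; [apply ex_derive_C_id|apply ex_derive_C_const]. }
  assert (Hf0 : f 0 = (c * l)%C).
  { unfold f. destruct (Ceq_dec 0 0) as [|E]; [reflexivity|]. exfalso; auto. }
  assert (Hfc : forall eps, 0 < eps -> exists d, 0 < d /\ forall z, Cmod z < d ->
     Cmod (f z - f 0) <= eps).
  { intros eps Heps. rewrite Hf0. generalize (Cmod_ge_0 c) (Cmod_ge_0 l). intros Hc0 Hl0.
    set (e1 := eps / (2 * (Cmod c + 1))).
    assert (He1 : 0 < e1) by (unfold e1; apply Rdiv_lt_0_compat; lra).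
    destruct (proj1 (is_derive_C F r l) Hl e1 He1) as [d [Hd0 H]].
    (* For [|z| < 1] also [|z|^2 < e2], which brings [q z^2 / p^2] below [e1], because
       [|q| <= |l| + e1]. *)
    set (e2 := e1 * (p * p) / (Cmod l + e1)).
    assert (He2 : 0 < e2) by (unfold e2; apply Rdiv_lt_0_compat; [apply Rmult_lt_0_compat|]; nra).
    exists (Rmin d (Rmin 1 e2)). split; [repeat apply Rmin_pos; lra|].
    intros z Hz.
    assert (Hz1 := Rlt_le_trans _ _ _ Hz (Rmin_l _ _)).
    assert (Hz2 := Rlt_le_trans _ _ _ Hz (Rmin_r _ _)).
    assert (Hz3 := Rlt_le_trans _ _ _ Hz2 (Rmin_l _ _)).
    assert (Hz4 := Rlt_le_trans _ _ _ Hz2 (Rmin_r _ _)).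
    unfold f. destruct (Ceq_dec z 0) as [E|E].
    { replace (c * l - c * l)%C with (RtoC 0) by ring. rewrite Cmod_0. lra. }
    assert (Hzp : 0 < Cmod z) by (apply Cmod_gt_0, E).
    set (q := ((F (r + 1 * z) - F r) * / z)%C).
    assert (Hq : Cmod (q - l) <= e1).
    { specialize (H (r + 1 * z)%C). replace (r + 1 * z - r)%C with z in H by ring.
      specialize (H Hz1). unfold q.
      replace ((F (r + 1 * z) - F r) * / z - l)%C with
        ((F (r + 1 * z) - F r - l * z) * / z)%C by (field; exact E).
      rewrite Cmod_mult, Cmod_inv by exact E.
      apply Rmult_le_reg_r with (Cmod z); [exact Hzp|].
      rewrite Rmult_assoc, Rinv_l, Rmult_1_r by lra. exact H. }
    assert (Hqm : Cmod q <= Cmod l + e1).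
    { generalize (Cmod_triangle (q - l) l). replace (q - l + l)%C with q by ring. lra. }
    replace (c * (F (r + 1 * z) - F r) * W z - c * l)%C with
      (c * ((q - l) - q * (z * z * (/ RtoC p * / RtoC p))))%C
      by (unfold q, W; field; split; [exact Hp0|exact E]).
    rewrite Cmod_mult.
    assert (Hs : Cmod (q * (z * z * (/ RtoC p * / RtoC p))) <= e1).
    { rewrite !Cmod_mult, !Cmod_inv, Cmod_R, (Rabs_pos_eq p) by (exact Hp0 || lra).
      apply Rmult_le_reg_r with (p * p); [nra|].
      replace (Cmod q * (Cmod z * Cmod z * (/ p * / p)) * (p * p)) with
        (Cmod q * (Cmod z * Cmod z)) by (field; lra).
      generalize (Cmod_ge_0 q); intros Hq0.
      apply Rle_trans with ((Cmod l + e1) * e2).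
      - apply Rmult_le_compat; nra.
      - right. unfold e2. field. lra. }
    assert (Cmod ((q - l) - q * (z * z * (/ RtoC p * / RtoC p))) <= 2 * e1).
    { unfold Cminus at 1. eapply Rle_trans; [apply Cmod_triangle|]. rewrite Cmod_opp. lra. }
    apply Rle_trans with (Cmod c * (2 * e1)); [apply Rmult_le_compat_l; lra|].
    replace eps with (2 * e1 * (Cmod c + 1)) by (unfold e1; field; lra). nra. }
  assert (Hp8 : 0 < p < 1 - r) by (unfold p; lra).
  assert (Hmv := mean_value_property f (1 - r) p Hfd Hfc Hp8).
  assert (Hex := ex_RInt_polar f (1 - r) p Hfd Hp8).
  destruct (RInt_even_part _ PI (Rlt_le _ _ HPI) Hex) as [Hex2 Hev].
  rewrite Hmv, Hf0 in Hev. unfold c in Hev at 1. rewrite re_conj_mult in Hev.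
  assert (HB0 : 0 <= B).
  { eapply Rle_trans; [apply Cmod_ge_0|apply (HB 0%C 0)].
    - unfold disk. rewrite Cmod_0. lra.
    - rewrite Rabs_R0. lra. }
  assert (Hbound : forall t, Re (f (polar p t)) + Re (f (polar p (- t))) <=
     Cmod l * (2 / p) * B).
  { intros t. set (z := polar p t). assert (Hz : Cmod z = p) by (apply Cmod_polar; lra).
    set (z' := polar p (- t)). assert (Hz' : Cmod z' = p) by (apply Cmod_polar; lra).
    assert (Hzz : (z * z')%C = (RtoC p * RtoC p)%C).
    { unfold z, z'. rewrite polar_mult. replace (t + - t) with 0 by ring.
      unfold polar. rewrite cos_0, sin_0. unfold RtoC, Cmult; simpl. f_equal; ring. }
    assert (Hz0 : z <> 0%C) by (apply Cmod_gt_0; lra).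
    assert (Hz0' : z' <> 0%C) by (apply Cmod_gt_0; lra).
    (* On this circle [/ z = z' / p^2], so [W z = (z' - z) / p^2], which is odd under exchanging [z]
       and [z']. *)
    assert (HW : W z' = (- W z)%C).
    { assert (H1 : (/ z = z' * (/ RtoC p * / RtoC p))%C).
      { transitivity ((RtoC p * RtoC p) * / z * (/ RtoC p * / RtoC p))%C; [field; auto|].
        rewrite <- Hzz. field. auto. }
      assert (H2 : (/ z' = z * (/ RtoC p * / RtoC p))%C).
      { transitivity ((RtoC p * RtoC p) * / z' * (/ RtoC p * / RtoC p))%C; [field; auto|].
        rewrite <- Hzz. field. auto. }
      unfold W. rewrite H1, H2. ring. }
    unfold f. destruct (Ceq_dec z 0); [contradiction|].
    destruct (Ceq_dec z' 0); [contradiction|]. rewrite HW.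
    (* The value [F r] at the centre cancels in the pair. *)
    replace (Re (c * (F (r + 1 * z) - F r) * W z)%C + Re (c * (F (r + 1 * z') - F r) * - W z)%C)
      with (Re (c * W z * (F (r + 1 * z) - F (r + 1 * z')))%C)
      by (rewrite !re_mult, !im_mult; unfold Re, Im; simpl; ring).
    eapply Rle_trans; [apply re_mult_le|]. rewrite Cmod_mult, Hcm.
    assert (HWm : Cmod (W z) <= 2 / p).
    { unfold W, Cminus. eapply Rle_trans; [apply Cmod_triangle|].
      rewrite Cmod_opp, !Cmod_mult, !Cmod_inv, Cmod_R, (Rabs_pos_eq p), Hz
        by (exact Hp0 || exact Hz0 || lra).
      right. field. lra. }
    assert (HFm : Cmod (F (r + 1 * z) - F (r + 1 * z'))%C <= B).
    { set (x := r + p * cos t). set (y := p * sin t).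
      generalize (COS_bound t) (SIN_bound t); intros Hcos Hsin.
      assert (Hx : 1 / 2 <= x) by (unfold x, p; nra).
      destruct (rotation_of_conj x y) as [a [Ha Hrot]]; [lra|].
      replace (r + 1 * z)%C with ((x, y) : C)
        by (unfold x, y, z, polar, RtoC, Cplus, Cmult; simpl; f_equal; ring).
      assert (E : (r + 1 * z')%C = ((x, (- y)%R) : C)).
      { unfold x, y, z', polar. rewrite cos_neg, sin_neg.
        unfold RtoC, Cplus, Cmult; simpl; f_equal; ring. }
      rewrite E, Hrot. apply HB.
      - rewrite <- E. apply Hdisk. lra.
      - eapply Rle_lt_trans; [exact Ha|]. unfold Rdiv. rewrite Rabs_mult.
        rewrite (Rabs_pos_eq (/ x)) by (left; apply Rinv_0_lt_compat; lra).
        assert (Hy : Rabs y <= p).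
        { unfold y. apply Rabs_le; nra. }
        assert (Hix : / x <= 2).
        { replace 2 with (/ (1 / 2)) by field. apply Rinv_le_contravar; lra. }
        assert (0 < / x) by (apply Rinv_0_lt_compat; lra).
        generalize (Rabs_pos y); intros. unfold p in *. nra. }
    assert (0 < 2 / p) by (apply Rdiv_lt_0_compat; lra).
    generalize (Cmod_ge_0 l) (Cmod_ge_0 (W z))
      (Cmod_ge_0 (F (r + 1 * z) - F (r + 1 * z'))%C); intros.
    apply Rmult_le_compat; [nra|assumption| |assumption].
    apply Rmult_le_compat_l; assumption. }
  assert (Hle : RInt (fun t => Re (f (polar p t)) + Re (f (polar p (- t)))) (- PI) PI <=
     RInt (fun _ => Cmod l * (2 / p) * B) (- PI) PI).
  { apply RInt_le; [lra|exact Hex2|apply @ex_RInt_const|]. intros t _. apply Hbound. }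
  rewrite Hev, RInt_Rconst in Hle.
  (* [Hle] now reads [4 PI |l|^2 <= 4 PI |l| B / p]; a factor [|l|] is cancelled, so [l = 0] is
     treated apart. *)
  destruct (Rle_lt_or_eq_dec _ _ (Cmod_ge_0 l)) as [Hlp|Hl0].
  - apply Rmult_le_reg_l with (4 * PI * Cmod l); [nra|].
    replace (8 * B / (1 - r)) with (B / p) by (unfold p; field; lra).
    replace (4 * PI * Cmod l * (B / p)) with ((PI - - PI) * (Cmod l * (2 / p) * B))
      by (field; lra). lra.
  - rewrite <- Hl0. apply Rdiv_le_0_compat; lra.
Qed.

(** Composing with the rotation [u] moves [z] to the positive radius without changing moduli. For
    each fixed angle [a] the increment [g] is analytic and continuous up to the circle, where [HB]
    bounds it. *)
Lemma derive_bound_of_boundary (F : C -> C) (z l : C) (B : R) :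
  continuous_on closed_disk F ->
  (forall w : C, disk w -> ex_derive F w) ->
  3 / 4 <= Cmod z < 1 ->
  (forall s t, Rabs (s - t) < 1 - Cmod z -> Cmod (F (polar 1 s) - F (polar 1 t)) <= B) ->
  is_derive F z l ->
  Cmod l <= 8 * B / (1 - Cmod z).
Proof.
  intros Hc Hd Hz HB Hl. destruct (polar_exists z) as [t Ht].
  set (r := Cmod z) in *. set (u := polar 1 t).
  assert (Hu : Cmod u = 1) by (apply Cmod_polar; lra).
  (* The summand [0] gives the rotation the shape expected by [is_derive_C_affine]. *)
  assert (Hzu : z = (0 + u * r)%C).
  { rewrite Ht. unfold u, polar, RtoC, Cmult, Cplus; simpl. f_equal; ring. }
  replace (Cmod l) with (Cmod (u * l)) by (rewrite Cmod_mult, Hu; ring).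
  apply (derive_bound_on_radius (fun w => F (0 + u * w)%C)).
  - exact Hz.
  - intros w Hw. apply (ex_derive_C_comp F (fun w => 0 + u * w)%C).
    + apply Hd. unfold disk in *. rewrite Cplus_0_l, Cmod_mult, Hu. lra.
    + eexists; apply is_derive_C_affine.
  - intros w a Hw Ha.
    set (g := fun v : C => (F (0 + polar 1 a * v) - F v)%C).
    assert (Hpa : Cmod (polar 1 a) = 1) by (apply Cmod_polar; lra).
    assert (Hrot : forall v, Cmod (0 + polar 1 a * v) = Cmod v).
    { intros v. rewrite Cplus_0_l, Cmod_mult, Hpa. ring. }
    assert (Hg : Cmod (g (u * w)%C) <= B).
    { apply maximum_modulus.
      - apply continuous_on_C. intros v Hv e He.
        destruct (proj1 (continuous_on_C closed_disk F) Hc v Hv (e / 2)) as [d1 [Hd1 H1]];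
          [lra|].
        destruct (proj1 (continuous_on_C closed_disk F) Hc (0 + polar 1 a * v)%C) with (eps := e / 2)
          as [d2 [Hd2 H2]]; [unfold closed_disk; rewrite Hrot; exact Hv|lra|].
        exists (Rmin d1 d2). split; [apply Rmin_pos; assumption|]. intros v' Hv' Hvv.
        specialize (H1 v' Hv' (Rlt_le_trans _ _ _ Hvv (Rmin_l _ _))).
        unfold g.
        replace (F (0 + polar 1 a * v') - F v' - (F (0 + polar 1 a * v) - F v))%C
          with ((F (0 + polar 1 a * v') - F (0 + polar 1 a * v)) + - (F v' - F v))%C by ring.
        eapply Rle_lt_trans; [apply Cmod_triangle|]. rewrite Cmod_opp.
        assert (Cmod (F (0 + polar 1 a * v')%C - F (0 + polar 1 a * v)%C) < e / 2).
        { apply H2.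
          - unfold closed_disk. rewrite Hrot. exact Hv'.
          - replace (0 + polar 1 a * v' - (0 + polar 1 a * v))%C with
              (0 + polar 1 a * (v' - v))%C by ring.
            rewrite Hrot. apply (Rlt_le_trans _ _ _ Hvv (Rmin_r _ _)). }
        lra.
      - intros v Hv. apply ex_derive_C_minus; [|apply Hd, Hv].
        apply (ex_derive_C_comp F (fun v => 0 + polar 1 a * v)%C).
        + apply Hd. unfold disk. rewrite Hrot. exact Hv.
        + eexists; apply is_derive_C_affine.
      - intros v Hv. destruct (polar_exists v) as [s Hs]. rewrite Hv in Hs. unfold g.
        rewrite Cplus_0_l, Hs, polar_mult, Rmult_1_l. apply HB.
        replace (a + s - s) with a by ring. exact Ha.
      - unfold closed_disk, disk in *. rewrite Cmod_mult, Hu. lra. }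
    unfold g in Hg.
    replace (0 + u * (polar 1 a * w))%C with (0 + polar 1 a * (u * w))%C by ring.
    replace (0 + u * w)%C with (u * w)%C by ring. exact Hg.
  - apply (is_derive_C_comp F (fun w => 0 + u * w)%C).
    + rewrite <- Hzu. exact Hl.
    + apply is_derive_C_affine.
Qed.

(** * Piecewise smooth curves and the distance *)

(** [C1_on] in epsilon-delta form, with the derivative named. *)
Definition C1_arc (g dg : R -> C) (a b : R) : Prop :=
  (forall t, a <= t <= b -> forall eps, 0 < eps -> exists d, 0 < d /\
     forall s, a <= s <= b -> Rabs (s - t) < d ->
       Cmod (g s - g t - (s - t)%R * dg t) <= eps * Rabs (s - t)) /\
  (forall t, a <= t <= b -> forall eps, 0 < eps -> exists d, 0 < d /\
     forall s, a <= s <= b -> Rabs (s - t) < d -> Cmod (dg s - dg t) < eps).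

(** Curves are differentiated in the real product space; its norm, and in the next lemma its
    scaling, are identified with those of [C]. *)
Lemma prod_norm_Cmod (z : C) :
  norm (z : prod_NormedModule R_AbsRing R_NormedModule R_NormedModule) = Cmod z.
Proof.
  change (sqrt (Rabs (fst z) ^ 2 + Rabs (snd z) ^ 2) = Cmod z).
  rewrite !pow2_abs. reflexivity.
Qed.

Lemma scal_RtoC (h : R) (z : C) :
  @scal R_Ring (prod_ModuleSpace R_Ring R_ModuleSpace R_ModuleSpace) h z = (RtoC h * z)%C.
Proof.
  destruct z as [x y]. unfold Cmult, RtoC; simpl.
  change ((h * x, h * y) = (h * x - 0 * y, h * y + 0 * x)). f_equal; ring.
Qed.

Lemma C1_on_arc (g : R -> C) (a b : R) :
  C1_on g a b <-> exists dg, C1_arc g dg a b.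
Proof.
  split.
  - intros [dg [H1 H2]]. exists dg. split.
    + intros t Ht eps Heps. destruct (H1 t Ht) as [_ H].
      assert (Hlim : is_filter_lim (within (fun s => a <= s <= b) (locally t)) t).
      { intros P HP. apply filter_le_within, HP. }
      specialize (H t Hlim (mkposreal _ Heps)).
      destruct H as [d Hd]. exists d. split; [apply cond_pos|].
      intros s Hs Hst. specialize (Hd s Hst Hs). simpl in Hd.
      rewrite prod_norm_Cmod, scal_RtoC in Hd. exact Hd.
    + intros t Ht eps Heps.
      assert (Hl : locally (dg t) (fun v => Cmod (v - dg t) < eps))
        by (apply locally_Cmod; exists eps; auto).
      destruct (H2 t Ht _ Hl) as [d Hd]. exists d. split; [apply cond_pos|].
      intros s Hs Hst. exact (Hd s Hst Hs).
  - intros [dg [H1 H2]]. exists dg. split.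
    + intros t Ht. split.
      { apply (is_linear_scal_l (K := R_AbsRing)
          (V := prod_NormedModule R_AbsRing R_NormedModule R_NormedModule)). }
      intros x Hx.
      assert (E : t = x).
      { apply NNPP; intros Hne. assert (Hp : 0 < Rabs (t - x)) by (apply Rabs_pos_lt; lra).
        specialize (Hx (fun s => Rabs (s - x) < Rabs (t - x))).
        destruct Hx as [d Hd].
        - exists (mkposreal _ Hp). intros s Hs. exact Hs.
        - specialize (Hd t (ball_center _ _) Ht). simpl in Hd. lra. }
      subst x. intros eps. destruct (H1 t Ht eps (cond_pos eps)) as [d [Hd Hd']].
      exists (mkposreal _ Hd). intros s Hst Hs. specialize (Hd' s Hs Hst).
      rewrite prod_norm_Cmod, scal_RtoC. exact Hd'.
    + intros t Ht P HP. apply locally_Cmod in HP. destruct HP as [e [He HP]].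
      destruct (H2 t Ht e He) as [d [Hd Hd']]. exists (mkposreal _ Hd).
      intros s Hst Hs. apply HP, Hd'; assumption.
Qed.

Lemma C1_arc_ext (g h dg : R -> C) (a b : R) :
  (forall t, a <= t <= b -> g t = h t) -> C1_arc g dg a b -> C1_arc h dg a b.
Proof.
  intros E [H1 H2]. split; [|exact H2]. intros t Ht eps Heps.
  destruct (H1 t Ht eps Heps) as [d [Hd H]]. exists d. split; [exact Hd|].
  intros s Hs Hst. rewrite <- !E by assumption. auto.
Qed.

Lemma C1_arc_shift (g dg : R -> C) (a b k : R) :
  C1_arc g dg a b -> C1_arc (fun t => g (t + k)) (fun t => dg (t + k)) (a - k) (b - k).
Proof.
  intros [H1 H2]. split; intros t Ht eps Heps.
  - destruct (H1 (t + k)) with (eps := eps) as [d [Hd H]]; [lra|exact Heps|].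
    exists d. split; [exact Hd|]. intros s Hs Hst.
    replace (s - t) with (s + k - (t + k)) in * by ring. apply H; [lra|exact Hst].
  - destruct (H2 (t + k)) with (eps := eps) as [d [Hd H]]; [lra|exact Heps|].
    exists d. split; [exact Hd|]. intros s Hs Hst.
    replace (s - t) with (s + k - (t + k)) in * by ring. apply H; [lra|exact Hst].
Qed.

Lemma C1_arc_continuous (g dg : R -> C) (a b t : R) :
  C1_arc g dg a b -> a <= t <= b -> forall eps, 0 < eps -> exists d, 0 < d /\
    forall s, a <= s <= b -> Rabs (s - t) < d -> Cmod (g s - g t) < eps.
Proof.
  intros [H1 _] Ht eps Heps. destruct (H1 t Ht 1 Rlt_0_1) as [d [Hd H]].
  generalize (Cmod_ge_0 (dg t)); intros Hdg.
  assert (Hq : 0 < eps / (Cmod (dg t) + 2)) by (apply Rdiv_lt_0_compat; lra).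
  exists (Rmin d (eps / (Cmod (dg t) + 2))). split; [apply Rmin_pos; assumption|].
  intros s Hs Hst.
  specialize (H s Hs (Rlt_le_trans _ _ _ Hst (Rmin_l _ _))).
  assert (Hst2 := Rlt_le_trans _ _ _ Hst (Rmin_r _ _)).
  replace (g s - g t)%C with ((g s - g t - (s - t)%R * dg t) + (s - t)%R * dg t)%C by ring.
  apply Rle_lt_trans with (1 := Cmod_triangle _ _). rewrite Cmod_mult, Cmod_R.
  replace eps with (eps / (Cmod (dg t) + 2) * (Cmod (dg t) + 2)) by (field; lra).
  generalize (Rabs_pos (s - t)); intros. nra.
Qed.

Lemma velocity_C1_arc (g dg : R -> C) (a b t : R) :
  C1_arc g dg a b -> a < t < b -> velocity g t = dg t.
Proof.
  intros [H1 _] Ht.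
  (* One argument for both coordinates: [pr] stands for [Re] and for [Im]. *)
  assert (Hpart : forall pr : C -> R,
    (forall z w, pr (z - w)%C = pr z - pr w) ->
    (forall (h : R) z, pr (h * z)%C = h * pr z) -> (forall z, Rabs (pr z) <= Cmod z) ->
    Derive (fun s => pr (g s)) t = pr (dg t)).
  { intros pr Hsub Hscal Hle. apply is_derive_unique, is_derive_Reals. intros eps Heps.
    destruct (H1 t) with (eps := eps / 2) as [d [Hd H]]; [lra|lra|].
    assert (Hm : 0 < Rmin d (Rmin (t - a) (b - t))) by (repeat apply Rmin_pos; lra).
    exists (mkposreal _ Hm). simpl. intros h Hh Hhd.
    assert (Hh1 := Rlt_le_trans _ _ _ Hhd (Rmin_l _ _)).
    assert (Hh2 := Rlt_le_trans _ _ _ Hhd (Rmin_r _ _)).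
    assert (Hh3 := Rlt_le_trans _ _ _ Hh2 (Rmin_l _ _)).
    assert (Hh4 := Rlt_le_trans _ _ _ Hh2 (Rmin_r _ _)).
    apply Rabs_def2 in Hh3. apply Rabs_def2 in Hh4.
    specialize (H (t + h)). replace (t + h - t) with h in H by ring.
    assert (Hab : a <= t + h <= b) by lra. specialize (H Hab Hh1).
    assert (Hp : 0 < Rabs h) by (apply Rabs_pos_lt, Hh).
    replace ((pr (g (t + h)) - pr (g t)) / h - pr (dg t))
      with (pr (g (t + h)%R - g t - h * dg t)%C / h)
      by (rewrite !Hsub, Hscal; field; exact Hh).
    unfold Rdiv. rewrite Rabs_mult, Rabs_inv.
    apply Rmult_lt_reg_r with (Rabs h); [exact Hp|].
    rewrite Rmult_assoc, Rinv_l, Rmult_1_r by lra.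
    eapply Rle_lt_trans; [apply Hle|]. eapply Rle_lt_trans; [exact H|]. nra. }
  unfold velocity. rewrite (Hpart Re), (Hpart Im).
  - destruct (dg t); reflexivity.
  - intros; unfold Im; simpl; ring.
  - intros; unfold Im; simpl; ring.
  - intros z. eapply Rle_trans; [|apply Rmax_Cmod]. apply Rmax_r.
  - intros; unfold Re; simpl; ring.
  - intros; unfold Re; simpl; ring.
  - apply re_le_Cmod.
Qed.

(** Projection onto [[a, b]] is 1-Lipschitz, so extending [h] by its end values turns one-sided
    continuity at the ends into continuity on the line. *)
Lemma continuous_clamp (h : R -> R) (a b : R) : a <= b ->
  (forall t, a <= t <= b -> forall eps, 0 < eps -> exists d, 0 < d /\
     forall s, a <= s <= b -> Rabs (s - t) < d -> Rabs (h s - h t) < eps) ->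
  forall t, continuous (fun t => h (Rmax a (Rmin b t))) t.
Proof.
  intros Hab H t P [e HP].
  assert (Hcl : forall t, a <= Rmax a (Rmin b t) <= b).
  { intros u. split; [apply Rmax_l|]. apply Rmax_lub; [exact Hab|apply Rmin_l]. }
  destruct (H _ (Hcl t) e (cond_pos e)) as [d [Hd Hd']].
  exists (mkposreal _ Hd). intros s Hs. apply HP. apply Hd'; [apply Hcl|].
  assert (Hs' : Rabs (s - t) < d) by exact Hs. clear Hs.
  eapply Rle_lt_trans; [|exact Hs']. apply Rabs_le.
  generalize (Rle_abs (s - t)) (Rle_abs (- (s - t))). rewrite Rabs_Ropp. intros.
  unfold Rmax, Rmin; repeat destruct Rle_dec; lra.
Qed.

Lemma metric_on_continuous (D : C -> Prop) (rho : C -> R) :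
  metric_on D rho -> forall z, D z -> forall eps, 0 < eps -> exists d, 0 < d /\
    forall w, D w -> Cmod (w - z) < d -> Rabs (rho w - rho z) < eps.
Proof. intros [_ H]. exact (proj1 (continuous_on_R D rho) H). Qed.

(** [velocity] can be wrong at [a] and [b]; the integrand is therefore exchanged for a globally
    continuous [l] that agrees with it inside. *)
Lemma arc_speed (D : C -> Prop) (rho : C -> R) (g dg : R -> C) (a b : R) :
  metric_on D rho -> a < b -> C1_arc g dg a b -> (forall t, a <= t <= b -> D (g t)) ->
  exists l : R -> R,
    (forall t, continuous l t) /\
    (forall t, a <= t <= b -> l t = rho (g t) * Cmod (dg t)) /\
    (forall t, a < t < b -> rho (g t) * Cmod (velocity g t) = l t).
Proof.
  intros Hrho Hab Hg HD.
  set (cl := fun t => Rmax a (Rmin b t)).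
  assert (Hcl : forall t, a <= t <= b -> cl t = t).
  { intros t Ht. unfold cl. rewrite Rmin_right, Rmax_right by lra. reflexivity. }
  exists (fun t => rho (g (cl t)) * Cmod (dg (cl t))). split; [|split].
  - intros t. apply (continuous_mult (K := R_AbsRing) (fun t => rho (g (cl t)))
      (fun t => Cmod (dg (cl t)))).
    + apply (continuous_clamp (fun t => rho (g t))); [lra|]. intros u Hu eps Heps.
      destruct (metric_on_continuous D rho Hrho (g u) (HD u Hu) eps Heps) as [d [Hd H]].
      destruct (C1_arc_continuous g dg a b u Hg Hu d Hd) as [d' [Hd' H']].
      exists d'. split; [exact Hd'|]. intros s Hs Hsu. apply H; auto.
    + apply (continuous_clamp (fun t => Cmod (dg t))); [lra|]. intros u Hu eps Heps.
      destruct (proj2 Hg u Hu eps Heps) as [d [Hd H]]. exists d. split; [exact Hd|].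
      intros s Hs Hsu. eapply Rle_lt_trans; [|apply (H s Hs Hsu)].
      generalize (Cmod_triangle (dg s - dg u) (dg u)) (Cmod_triangle (dg u - dg s) (dg s)).
      replace (dg s - dg u + dg u)%C with (dg s) by ring.
      replace (dg u - dg s + dg s)%C with (dg u) by ring.
      rewrite (Cmod_sub_sym (dg u)). intros. apply Rabs_le; lra.
  - intros t Ht. rewrite Hcl by exact Ht. reflexivity.
  - intros t Ht. rewrite Hcl by lra. rewrite (velocity_C1_arc g dg a b) by assumption.
    reflexivity.
Qed.

(* Each such [psi] gives the lower bound [psi w - psi z <= rho_dist D rho z w]. *)
Definition locally_dominated (D : C -> Prop) (rho psi : C -> R) : Prop :=
  forall p, D p -> exists d, 0 < d /\ forall q, D q -> Cmod (q - p) < d ->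
    Rabs (psi q - psi p) <= rho p * Cmod (q - p).

(** [psi] need not be differentiable: near each [t] its increment along [g] is at most
    [l t + eps / 2] per unit of time, and [subadditive_interval_nonpos] integrates this.
    Integrability is recorded as well, since joining arcs with [RInt] requires it. *)
Lemma arc_length_lower_bound (D : C -> Prop) (rho psi : C -> R) (g : R -> C) (a b : R) :
  metric_on D rho -> locally_dominated D rho psi -> a < b -> C1_on g a b ->
  (forall t, a <= t <= b -> D (g t)) ->
  ex_RInt (fun t => rho (g t) * Cmod (velocity g t)) a b /\
  psi (g b) - psi (g a) <= rho_length rho g a b.
Proof.
  intros Hrho Hpsi Hab Hg HD. apply C1_on_arc in Hg. destruct Hg as [dg Hg].
  destruct (arc_speed D rho g dg a b Hrho Hab Hg HD) as [l [Hlc [Hl1 Hl2]]].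
  assert (Hint : forall x y, ex_RInt l x y)
    by (intros; apply @ex_RInt_continuous; intros; apply Hlc).
  split.
  { apply ex_RInt_ext with l; [|apply Hint]. intros t Ht.
    rewrite Rmin_left, Rmax_right in Ht by lra. symmetry; apply Hl2, Ht. }
  unfold rho_length. rewrite (RInt_ext _ l).
  2:{ intros t Ht. rewrite Rmin_left, Rmax_right in Ht by lra. apply Hl2, Ht. }
  apply Rminus_le.
  apply (subadditive_interval_nonpos (fun s t => psi (g t) - psi (g s) - RInt l s t)); [exact Hab| |].
  - intros x y z _ _ _ _. rewrite <- (RInt_Chasles l x y z) by apply Hint.
    unfold plus; simpl. right. ring.
  - intros t Ht eps Heps.
    assert (Hrp : 0 < rho (g t)) by (apply (proj1 Hrho), HD, Ht).
    destruct (Hpsi (g t) (HD t Ht)) as [d1 [Hd1 H1]].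
    destruct (C1_arc_continuous g dg a b t Hg Ht d1 Hd1) as [d2 [Hd2 H2]].
    destruct (proj1 Hg t Ht (eps / 2 / rho (g t))) as [d3 [Hd3 H3]];
      [apply Rdiv_lt_0_compat; lra|].
    assert (He2 : 0 < eps / 2) by lra.
    destruct (Hlc t (fun v => Rabs (v - l t) < eps / 2)) as [d4 Hd4];
      [exists (mkposreal _ He2); intros v Hv; exact Hv|].
    exists (Rmin (Rmin d2 d3) d4).
    split; [repeat apply Rmin_pos; try assumption; apply cond_pos|].
    intros s Hs Hst.
    assert (S1 := Rlt_le_trans _ _ _ Hst (Rmin_l _ _)).
    assert (S4 := Rlt_le_trans _ _ _ Hst (Rmin_r _ _)).
    assert (S2 := Rlt_le_trans _ _ _ S1 (Rmin_l _ _)).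
    assert (S3 := Rlt_le_trans _ _ _ S1 (Rmin_r _ _)).
    assert (Hps : Rabs (psi (g s) - psi (g t)) <= (l t + eps / 2) * Rabs (s - t)).
    { eapply Rle_trans; [apply H1; [apply HD, Hs|apply H2; assumption]|].
      specialize (H3 s Hs S3).
      assert (Hgs : Cmod (g s - g t) <= (Cmod (dg t) + eps / 2 / rho (g t)) * Rabs (s - t)).
      { replace (g s - g t)%C with ((g s - g t - (s - t)%R * dg t) + (s - t)%R * dg t)%C by ring.
        eapply Rle_trans; [apply Cmod_triangle|]. rewrite Cmod_mult, Cmod_R. lra. }
      rewrite Hl1 by exact Ht.
      replace ((rho (g t) * Cmod (dg t) + eps / 2) * Rabs (s - t)) with
        (rho (g t) * ((Cmod (dg t) + eps / 2 / rho (g t)) * Rabs (s - t))) by (field; lra).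
      apply Rmult_le_compat_l; lra. }
    apply Rabs_le_between in Hps.
    assert (Hl4 : forall u, Rabs (u - t) < d4 -> Rabs (l u - l t) <= eps / 2)
      by (intros u Hu; left; apply Hd4, Hu).
    split; intros Hord.
    + assert (HI := RInt_near_const l s t (l t) (eps / 2) Hord (Hint _ _)).
      rewrite Rabs_left1 in Hps by lra. rewrite Rabs_left1 in S4 by lra.
      assert (Rabs (RInt l s t - l t * (t - s)) <= (t - s) * (eps / 2)).
      { apply HI. intros u Hu. apply Hl4. rewrite Rabs_left1; lra. }
      apply Rabs_le_between in H. lra.
    + assert (HI := RInt_near_const l t s (l t) (eps / 2) Hord (Hint _ _)).
      rewrite Rabs_pos_eq in Hps by lra. rewrite Rabs_pos_eq in S4 by lra.
      assert (Rabs (RInt l t s - l t * (s - t)) <= (s - t) * (eps / 2)).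
      { apply HI. intros u Hu. apply Hl4. rewrite Rabs_pos_eq; lra. }
      apply Rabs_le_between in H. lra.
Qed.

Lemma piecewise_C1_lt (g : R -> C) (a b : R) : piecewise_C1 g a b -> a < b.
Proof. induction 1; lra. Qed.

Lemma length_lower_bound (D : C -> Prop) (rho psi : C -> R) (g : R -> C) (a b : R) :
  metric_on D rho -> locally_dominated D rho psi -> piecewise_C1 g a b ->
  (forall t, a <= t <= b -> D (g t)) ->
  ex_RInt (fun t => rho (g t) * Cmod (velocity g t)) a b /\
  psi (g b) - psi (g a) <= rho_length rho g a b.
Proof.
  intros Hrho Hpsi H. induction H as [a b Hab Hg|a b c Hab Hg Hbc IH]; intros HD.
  - apply (arc_length_lower_bound D); assumption.
  - apply piecewise_C1_lt in Hbc.
    destruct (arc_length_lower_bound D rho psi g a b Hrho Hpsi Hab Hg) as [E1 L1];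
      [intros; apply HD; lra|].
    destruct IH as [E2 L2]; [intros; apply HD; lra|].
    split; [exact (ex_RInt_Chasles _ _ _ _ E1 E2)|].
    unfold rho_length in *. rewrite <- (RInt_Chasles _ a b c E1 E2).
    unfold plus; simpl. lra.
Qed.

Lemma piecewise_C1_ext (g h : R -> C) (a b : R) :
  (forall t, a <= t <= b -> g t = h t) -> piecewise_C1 g a b -> piecewise_C1 h a b.
Proof.
  intros E H. induction H as [a b Hab Hg|a b c Hab Hg Hbc IH].
  - apply piecewise_C1_arc; [exact Hab|]. apply C1_on_arc in Hg. destruct Hg as [dg Hg].
    apply C1_on_arc. exists dg. exact (C1_arc_ext g h dg a b E Hg).
  - assert (Hlt := piecewise_C1_lt _ _ _ Hbc).
    apply piecewise_C1_cons with b; [exact Hab| |apply IH; intros; apply E; lra].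
    apply C1_on_arc in Hg. destruct Hg as [dg Hg].
    apply C1_on_arc. exists dg. apply (C1_arc_ext g h dg a b); [|exact Hg].
    intros; apply E; lra.
Qed.

Lemma piecewise_C1_shift (g : R -> C) (a b k : R) :
  piecewise_C1 g a b -> piecewise_C1 (fun t => g (t + k)) (a - k) (b - k).
Proof.
  assert (Harc : forall a b, C1_on g a b -> C1_on (fun t => g (t + k)) (a - k) (b - k)).
  { intros x y Hg. apply C1_on_arc in Hg. destruct Hg as [dg Hg]. apply C1_on_arc.
    exists (fun t => dg (t + k)). apply C1_arc_shift, Hg. }
  intros H. induction H as [a b Hab Hg|a b c Hab Hg Hbc IH].
  - apply piecewise_C1_arc; [lra|auto].
  - apply piecewise_C1_cons with (b - k); [lra|auto|exact IH].
Qed.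

Lemma piecewise_C1_concat (g : R -> C) (a b c : R) :
  piecewise_C1 g a b -> piecewise_C1 g b c -> piecewise_C1 g a c.
Proof.
  intros H Hc. induction H as [a b Hab Hg|a b b' Hab Hg Hbc IH].
  - apply piecewise_C1_cons with b; assumption.
  - apply piecewise_C1_cons with b; auto.
Qed.

Lemma velocity_shift (g : R -> C) (k t : R) :
  velocity (fun s => g (s + k)) t = velocity g (t + k).
Proof.
  assert (H : forall u : R -> R, Derive (fun s => u (s + k)) t = Derive u (t + k)).
  { intros u. unfold Derive. f_equal. apply Lim_ext. intros h.
    replace (t + h + k) with (t + k + h) by ring. reflexivity. }
  unfold velocity. f_equal; [apply (H (fun s => Re (g s)))|apply (H (fun s => Im (g s)))].
Qed.

Lemma velocity_ext_loc (g h : R -> C) (t : R) :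
  locally t (fun s => g s = h s) -> velocity g t = velocity h t.
Proof.
  intros H. unfold velocity.
  f_equal; apply Derive_ext_loc; revert H; apply filter_imp; intros s E; rewrite E; reflexivity.
Qed.

Lemma locally_open_interval (a b t : R) (P : R -> Prop) :
  a < t < b -> (forall s, a < s < b -> P s) -> locally t P.
Proof.
  intros Ht H. assert (Hm : 0 < Rmin (t - a) (b - t)) by (apply Rmin_pos; lra).
  exists (mkposreal _ Hm). intros s Hs. assert (Hs' : Rabs (s - t) < Rmin (t - a) (b - t)) by exact Hs.
  assert (S1 := Rlt_le_trans _ _ _ Hs' (Rmin_l _ _)).
  assert (S2 := Rlt_le_trans _ _ _ Hs' (Rmin_r _ _)).
  apply Rabs_def2 in S1. apply Rabs_def2 in S2. apply H; lra.
Qed.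

(** With a constant test function, [length_lower_bound] yields integrability of the speed and
    nonnegativity of the length. *)
Lemma locally_dominated_const (D : C -> Prop) (rho : C -> R) (c : R) :
  metric_on D rho -> locally_dominated D rho (fun _ => c).
Proof.
  intros [Hpos _] p Hp. exists 1. split; [lra|]. intros q _ _.
  replace (c - c) with 0 by ring. rewrite Rabs_R0.
  apply Rmult_le_pos; [left; auto|apply Cmod_ge_0].
Qed.

Lemma joins_concat (D : C -> Prop) (rho : C -> R) (z w v : C) (g1 g2 : R -> C) (a b c d : R) :
  metric_on D rho -> joins D z w g1 a b -> joins D w v g2 c d ->
  exists g e, joins D z v g a e /\
    rho_length rho g a e = rho_length rho g1 a b + rho_length rho g2 c d.
Proof.
  intros Hrho [P1 [D1 [A1 B1]]] [P2 [D2 [A2 B2]]].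
  assert (L1 := piecewise_C1_lt _ _ _ P1). assert (L2 := piecewise_C1_lt _ _ _ P2).
  set (k := c - b). set (e := d - k).
  set (g := fun t => if Rle_dec t b then g1 t else g2 (t + k)).
  assert (G1 : forall t, t <= b -> g t = g1 t).
  { intros t Ht. unfold g. destruct (Rle_dec t b); [reflexivity|contradiction]. }
  assert (G2 : forall t, b <= t -> g t = g2 (t + k)).
  { intros t Ht. unfold g. destruct (Rle_dec t b); [|reflexivity].
    replace t with b by lra. unfold k. replace (b + (c - b)) with c by ring.
    rewrite A2, B1. reflexivity. }
  assert (P1' : piecewise_C1 g a b).
  { apply (piecewise_C1_ext g1); [|exact P1]. intros; symmetry; apply G1; lra. }
  assert (P2' : piecewise_C1 g b e).
  { apply (piecewise_C1_ext (fun t => g2 (t + k))); [intros; symmetry; apply G2; lra|].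
    replace b with (c - k) by (unfold k; ring). apply piecewise_C1_shift, P2. }
  assert (DD : forall t, a <= t <= e -> D (g t)).
  { intros t Ht. destruct (Rle_dec t b).
    - rewrite G1 by assumption. apply D1; lra.
    - rewrite G2 by lra. apply D2. unfold e, k in *; lra. }
  exists g, e. split; [split; [|split; [|split]]|].
  - exact (piecewise_C1_concat g a b e P1' P2').
  - exact DD.
  - rewrite G1 by lra. exact A1.
  - rewrite G2 by (unfold e, k; lra). unfold e. replace (d - k + k) with d by ring. exact B2.
  - assert (Hbe : b < e) by (unfold e, k; lra).
    assert (Hc := locally_dominated_const D rho 0 Hrho).
    destruct (length_lower_bound D rho _ g a b Hrho Hc P1') as [E1 _];
      [intros; apply DD; lra|].
    destruct (length_lower_bound D rho _ g b e Hrho Hc P2') as [E2 _];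
      [intros; apply DD; lra|].
    unfold rho_length. rewrite <- (RInt_Chasles _ a b e E1 E2). unfold plus; simpl.
    f_equal.
    + apply RInt_ext. intros t Ht. rewrite Rmin_left, Rmax_right in Ht by lra.
      rewrite G1 by lra. rewrite (velocity_ext_loc g g1); [reflexivity|].
      apply (locally_open_interval a b); [exact Ht|]. intros; apply G1; lra.
    + set (q := fun u => rho (g2 u) * Cmod (velocity g2 u)).
      assert (Hlin := RInt_comp_lin q 1 k b e).
      replace (1 * b + k) with c in Hlin by (unfold k; ring).
      replace (1 * e + k) with d in Hlin by (unfold e; ring).
      rewrite <- Hlin by exact (proj1 (length_lower_bound D rho _ g2 c d Hrho Hc P2 D2)).
      apply RInt_ext. intros t Ht. rewrite Rmin_left, Rmax_right in Ht by lra.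
      rewrite G2 by lra. rewrite (velocity_ext_loc g (fun s => g2 (s + k))).
      * rewrite velocity_shift. unfold scal; simpl. unfold mult, q; simpl.
        rewrite !Rmult_1_l. reflexivity.
      * apply (locally_open_interval b e); [exact Ht|]. intros; apply G2; lra.
Qed.

Definition segment (z w : C) (t : R) : C := (z + RtoC t * (w - z))%C.

Lemma C1_arc_segment (z w : C) (a b : R) : C1_arc (segment z w) (fun _ => (w - z)%C) a b.
Proof.
  split; intros t _ eps Heps; exists 1; (split; [lra|]); intros s _ _.
  - replace (segment z w s - segment z w t - (s - t)%R * (w - z))%C with (RtoC 0)
      by (unfold segment; rewrite RtoC_minus; ring).
    rewrite Cmod_0. apply Rmult_le_pos; [lra|apply Rabs_pos].
  - replace (w - z - (w - z))%C with (RtoC 0) by ring. rewrite Cmod_0. exact Heps.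
Qed.

Lemma joins_segment (D : C -> Prop) (z w : C) :
  (forall t, 0 <= t <= 1 -> D (segment z w t)) -> joins D z w (segment z w) 0 1.
Proof.
  intros HD. split; [|split; [exact HD|split; unfold segment; ring]].
  apply piecewise_C1_arc; [lra|]. apply C1_on_arc. exists (fun _ => (w - z)%C).
  apply C1_arc_segment.
Qed.

Lemma segment_in_ball (p z w : C) (r t : R) :
  Cmod (z - p) < r -> Cmod (w - p) < r -> 0 <= t <= 1 -> Cmod (segment z w t - p) < r.
Proof.
  intros Hz Hw Ht.
  replace (segment z w t - p)%C with (RtoC (1 - t) * (z - p) + RtoC t * (w - p))%C
    by (unfold segment; rewrite RtoC_minus; ring).
  eapply Rle_lt_trans; [apply Cmod_triangle|].
  rewrite !Cmod_mult, !Cmod_R, !Rabs_pos_eq by lra.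
  apply Rle_lt_trans with (Rmax (Cmod (z - p)) (Cmod (w - p))); [|apply Rmax_lub_lt; assumption].
  generalize (Rmax_l (Cmod (z - p)) (Cmod (w - p))) (Rmax_r (Cmod (z - p)) (Cmod (w - p))). intros. nra.
Qed.

(** Balls inside [D] are crossed by segments, so the points reachable from [z] and the unreachable
    ones form two open sets, which connectedness forbids to be both inhabited. *)
Lemma domain_path_connected (D : C -> Prop) (rho : C -> R) (z w : C) :
  metric_on D rho -> plane_domain D -> D z -> D w -> exists g a b, joins D z w g a b.
Proof.
  intros Hrho [_ [Ho Hc]] Hz Hw.
  set (reach := fun v => exists g a b, joins D z v g a b).
  apply NNPP; intros HN.
  assert (Hstep : forall p u v r, (forall q, Cmod (q - p) < r -> D q) -> Cmod (u - p) < r -> Cmod (v - p) < r ->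
     reach u -> reach v).
  { intros p u v r Hr Hu Hv [g [a [b Hj]]].
    assert (Hs : joins D u v (segment u v) 0 1).
    { apply joins_segment. intros t Ht. apply Hr, segment_in_ball; assumption. }
    destruct (joins_concat D rho _ _ _ _ _ _ _ _ _ Hrho Hj Hs) as [g' [e [H _]]].
    exists g', a, e. exact H. }
  destruct (Hc (fun v => D v /\ reach v) (fun v => D v /\ ~ reach v)) as [v [_ [[_ H1] [_ H2]]]].
  - intros p [Hp Hrp]. destruct (open_Cmod D Ho p Hp) as [r [Hr H]].
    apply locally_Cmod. exists r. split; [exact Hr|]. intros v Hv. split; [auto|].
    apply (Hstep p p v r); auto.
    replace (p - p)%C with (RtoC 0) by ring. rewrite Cmod_0. exact Hr.
  - intros p [Hp Hrp]. destruct (open_Cmod D Ho p Hp) as [r [Hr H]].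
    apply locally_Cmod. exists r. split; [exact Hr|]. intros v Hv. split; [auto|].
    intros Hrv. apply Hrp. apply (Hstep p v p r); auto.
    replace (p - p)%C with (RtoC 0) by ring. rewrite Cmod_0. exact Hr.
  - intros v Hv. destruct (classic (reach v)); auto.
  - exists z. split; [exact Hz|]. split; [exact Hz|]. exists (segment z z), 0, 1.
    apply joins_segment. intros t _. unfold segment.
    replace (z + t * (z - z))%C with z by ring. exact Hz.
  - exists w. split; [exact Hw|]. split; [exact Hw|exact HN].
  - contradiction.
Qed.

Lemma rho_length_nonneg (D : C -> Prop) (rho : C -> R) (z w : C) (g : R -> C) (a b : R) :
  metric_on D rho -> joins D z w g a b -> 0 <= rho_length rho g a b.
Proof.
  intros Hrho [P [HD _]].
  destruct (length_lower_bound D rho _ g a b Hrho (locally_dominated_const D rho 0 Hrho) P HD)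
    as [_ H]. lra.
Qed.

(** [real] would send an infinite infimum to [0]. Path connectedness excludes plus infinity and
    nonnegative lengths exclude minus infinity, so [rho_dist] is a true infimum. *)
Lemma rho_dist_glb (D : C -> Prop) (rho : C -> R) (z w : C) :
  metric_on D rho -> plane_domain D -> D z -> D w ->
  is_glb_Rbar (fun l => exists g a b, joins D z w g a b /\ l = rho_length rho g a b)
    (rho_dist D rho z w).
Proof.
  intros Hrho HD Hz Hw. unfold rho_dist.
  set (E := fun l : R => exists g a b, joins D z w g a b /\ l = rho_length rho g a b).
  assert (H := Glb_Rbar_correct E). destruct (Glb_Rbar E) as [r| |]; [exact H| |].
  - destruct (domain_path_connected D rho z w Hrho HD Hz Hw) as [g [a [b Hj]]].
    destruct (proj1 H (rho_length rho g a b)). exists g, a, b; auto.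
  - destruct (proj2 H (Finite 0)).
    intros l [g [a [b [Hj ->]]]]. exact (rho_length_nonneg D rho z w g a b Hrho Hj).
Qed.

(** * The distance: triangle inequality, local comparison with [rho], and the [rho]-derivative *)

Section Distance.

Context (D : C -> Prop) (rho : C -> R) (Hrho : metric_on D rho) (HD : plane_domain D).

Lemma rho_dist_le_length (z w : C) (g : R -> C) (a b : R) : D z -> D w ->
  joins D z w g a b -> rho_dist D rho z w <= rho_length rho g a b.
Proof.
  intros Hz Hw Hj. apply (proj1 (rho_dist_glb D rho z w Hrho HD Hz Hw)).
  exists g, a, b; auto.
Qed.

Lemma rho_dist_ge (z w : C) (c : R) : D z -> D w ->
  (forall g a b, joins D z w g a b -> c <= rho_length rho g a b) -> c <= rho_dist D rho z w.
Proof.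
  intros Hz Hw H. apply (proj2 (rho_dist_glb D rho z w Hrho HD Hz Hw) (Finite c)).
  intros l [g [a [b [Hj ->]]]]. exact (H g a b Hj).
Qed.

Lemma rho_dist_nonneg (z w : C) : D z -> D w -> 0 <= rho_dist D rho z w.
Proof.
  intros Hz Hw. apply rho_dist_ge; [exact Hz|exact Hw|]. intros g a b Hj.
  exact (rho_length_nonneg D rho z w g a b Hrho Hj).
Qed.

Lemma rho_dist_triangle (z w v : C) : D z -> D w -> D v ->
  rho_dist D rho z v <= rho_dist D rho z w + rho_dist D rho w v.
Proof.
  intros Hz Hw Hv. apply Rle_minus_l. apply rho_dist_ge; [exact Hz|exact Hw|].
  intros g1 a b H1.
  cut (rho_dist D rho z v - rho_length rho g1 a b <= rho_dist D rho w v); [lra|].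
  apply rho_dist_ge; [exact Hw|exact Hv|]. intros g2 c d H2.
  destruct (joins_concat D rho z w v g1 g2 a b c d Hrho H1 H2) as [g [e [H E]]].
  generalize (rho_dist_le_length z v g a e Hz Hv H). lra.
Qed.

Lemma rho_dist_lower_bound (psi : C -> R) (z w : C) : D z -> D w ->
  locally_dominated D rho psi -> psi w - psi z <= rho_dist D rho z w.
Proof.
  intros Hz Hw Hpsi. apply rho_dist_ge; [exact Hz|exact Hw|].
  intros g a b [P [HDg [<- <-]]].
  exact (proj2 (length_lower_bound D rho psi g a b Hrho Hpsi P HDg)).
Qed.

Lemma Rabs_Cmod_sub (x q p : C) : Rabs (Cmod (q - x) - Cmod (p - x)) <= Cmod (q - p).
Proof.
  generalize (Cmod_triangle_sub q p x) (Cmod_triangle_sub p q x).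
  rewrite (Cmod_sub_sym p q). intros. apply Rabs_le; lra.
Qed.

Lemma rho_dist_ge_euclidean (c : R) (z w : C) : 0 <= c -> (forall p, D p -> c <= rho p) ->
  D z -> D w -> c * Cmod (w - z) <= rho_dist D rho z w.
Proof.
  intros Hc Hlb Hz Hw.
  replace (c * Cmod (w - z)) with (c * Cmod (w - z) - c * Cmod (z - z)).
  - apply (rho_dist_lower_bound (fun v => c * Cmod (v - z))); [exact Hz|exact Hw|].
    intros p Hp. exists 1. split; [lra|]. intros q _ _.
    replace (c * Cmod (q - z) - c * Cmod (p - z)) with (c * (Cmod (q - z) - Cmod (p - z))) by ring.
    rewrite Rabs_mult, (Rabs_pos_eq c) by exact Hc.
    apply Rmult_le_compat; [exact Hc|apply Rabs_pos|auto|apply Rabs_Cmod_sub].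
  - replace (z - z)%C with (RtoC 0) by ring. rewrite Cmod_0. ring.
Qed.

Lemma domain_ball (p : C) (eps : R) : D p -> 0 < eps ->
  exists d, 0 < d /\ forall q, Cmod (q - p) < d -> D q /\ Rabs (rho q - rho p) < eps.
Proof.
  intros Hp Heps. destruct (open_Cmod D (proj1 (proj2 HD)) p Hp) as [d1 [Hd1 H1]].
  destruct (metric_on_continuous D rho Hrho p Hp eps Heps) as [d2 [Hd2 H2]].
  exists (Rmin d1 d2). split; [apply Rmin_pos; assumption|]. intros q Hq.
  assert (Q1 := Rlt_le_trans _ _ _ Hq (Rmin_l _ _)).
  assert (Q2 := Rlt_le_trans _ _ _ Hq (Rmin_r _ _)). auto.
Qed.

(** The segment stays in a ball where [rho <= rho p + eps]. Both end points are free, which covers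
    either order of the arguments. *)
Lemma rho_dist_local_upper (p : C) (eps : R) : D p -> 0 < eps ->
  exists d, 0 < d /\ forall z w, Cmod (z - p) < d -> Cmod (w - p) < d ->
    D z /\ D w /\ rho_dist D rho z w <= (rho p + eps) * Cmod (w - z).
Proof.
  intros Hp Heps. destruct (domain_ball p eps Hp Heps) as [d [Hd H]].
  exists d. split; [exact Hd|]. intros z w Hz Hw.
  assert (Dz : D z) by apply H, Hz. assert (Dw : D w) by apply H, Hw.
  split; [exact Dz|split; [exact Dw|]].
  assert (Hseg : forall t, 0 <= t <= 1 -> Cmod (segment z w t - p) < d)
    by (intros; apply segment_in_ball; assumption).
  assert (Hj : joins D z w (segment z w) 0 1)
    by (apply joins_segment; intros; apply H; auto).
  eapply Rle_trans; [apply (rho_dist_le_length z w _ 0 1 Dz Dw Hj)|].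
  unfold rho_length.
  replace ((rho p + eps) * Cmod (w - z)) with
    (RInt (fun _ => (rho p + eps) * Cmod (w - z)) 0 1) by (rewrite RInt_Rconst; Rring).
  apply RInt_le; [lra| |apply @ex_RInt_const|].
  - exact (proj1 (length_lower_bound D rho _ _ 0 1 Hrho (locally_dominated_const D rho 0 Hrho)
      (proj1 Hj) (proj1 (proj2 Hj)))).
  - intros t Ht. rewrite (velocity_C1_arc _ _ 0 1 t (C1_arc_segment z w 0 1) Ht).
    apply Rmult_le_compat_r; [apply Cmod_ge_0|].
    destruct (H (segment z w t)) as [_ Hr]; [apply Hseg; lra|].
    apply Rabs_def2 in Hr. lra.
Qed.

Lemma rho_dist_local_lower (p : C) (eps : R) : D p -> 0 < eps ->
  exists d, 0 < d /\ forall q, Cmod (q - p) < d ->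
    D q /\ (rho p - eps) * Cmod (q - p) <= rho_dist D rho p q.
Proof.
  intros Hp Heps. destruct (domain_ball p eps Hp Heps) as [r [Hr H]].
  exists (r / 2). split; [lra|]. intros q Hq.
  assert (Dq : D q) by (apply H; lra). split; [exact Dq|].
  set (m := rho p - eps). destruct (Rle_dec m 0) as [Hm|Hm].
  { eapply Rle_trans; [|apply (rho_dist_nonneg p q Hp Dq)].
    generalize (Cmod_ge_0 (q - p)). nra. }
  (* Truncated, so that curves leaving the ball cause no harm. *)
  set (psi := fun v => m * Rmin (Cmod (v - p)) (r / 2)).
  assert (Hpsi : locally_dominated D rho psi).
  { intros x Hx. exists (r / 2). split; [lra|]. intros y Hy Hyx. unfold psi.
    replace (m * Rmin (Cmod (y - p)) (r / 2) - m * Rmin (Cmod (x - p)) (r / 2)) with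
      (m * (Rmin (Cmod (y - p)) (r / 2) - Rmin (Cmod (x - p)) (r / 2))) by ring.
    rewrite Rabs_mult, (Rabs_pos_eq m) by lra.
    assert (Hs := Rabs_Cmod_sub p y x). assert (Hs' := proj1 (Rabs_le_between _ _) Hs).
    destruct (Rlt_dec (Cmod (x - p)) r) as [Hin|Hout].
    - apply Rmult_le_compat; [lra|apply Rabs_pos| |].
      + destruct (H x Hin) as [_ Hx']. apply Rabs_def2 in Hx'. unfold m; lra.
      + apply Rabs_le. unfold Rmin; repeat destruct Rle_dec; lra.
    (* Within [r / 2] of a point outside the ball the truncation is active, so [psi] is constant
       there. *)
    - rewrite !Rmin_right by lra. replace (r / 2 - r / 2) with 0 by ring.
      rewrite Rabs_R0, Rmult_0_r. apply Rmult_le_pos; [left; apply (proj1 Hrho), Hx|apply Cmod_ge_0]. }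
  generalize (rho_dist_lower_bound psi p q Hp Dq Hpsi). unfold psi.
  replace (p - p)%C with (RtoC 0) by ring. rewrite Cmod_0, !Rmin_left by lra. lra.
Qed.

(** [complete_cauchy] describes [lim] for proper Cauchy filters. The filter here concentrates at
    [l], hence is Cauchy, and a different limit would have a ball disjoint from one around [l]. *)
Lemma lim_filtermap_locally' (u : C -> R) (z : C) (l : R) :
  (forall eps, 0 < eps -> exists d, 0 < d /\ forall w, w <> z -> Cmod (w - z) < d ->
     Rabs (u w - l) <= eps) ->
  lim (filtermap u (locally' z)) = l.
Proof.
  intros H.
  assert (HF : ProperFilter (filtermap u (locally' z))).
  { constructor; [|apply filtermap_filter, within_filter, locally_filter].
    intros P HP. apply locally_Cmod in HP. destruct HP as [d [Hd HP]].
    (* Properness: a punctured neighbourhood contains a point other than [z]. *)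
    exists (u (z + RtoC (d / 2))%C).
    assert (E : (z + RtoC (d / 2) - z)%C = RtoC (d / 2)) by ring.
    apply HP.
    - rewrite E, Cmod_R, Rabs_pos_eq; lra.
    - intros E'. rewrite E' in E. replace (z - z)%C with (RtoC 0) in E by ring.
      apply RtoC_inj in E. lra. }
  assert (Hball : forall eps : posreal, filtermap u (locally' z) (ball l eps)).
  { intros eps. assert (He : 0 < eps / 2) by (generalize (cond_pos eps); lra).
    destruct (H _ He) as [d [Hd H']]. apply locally_Cmod. exists d. split; [exact Hd|].
    intros w Hw Hne. specialize (H' w Hne Hw).
    change (Rabs (u w - l) < eps). generalize (cond_pos eps). lra. }
  assert (Hc : cauchy (filtermap u (locally' z))) by (intros eps; exists l; apply Hball).
  apply NNPP; intros Hne.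
  set (L := lim (filtermap u (locally' z))) in *.
  assert (Hp : 0 < Rabs (L - l) / 2) by (assert (0 < Rabs (L - l)) by (apply Rabs_pos_lt; lra); lra).
  assert (H1 := complete_cauchy _ HF Hc (mkposreal _ Hp)). fold L in H1.
  assert (H2 := filter_and _ _ H1 (Hball (mkposreal _ Hp))).
  destruct (filter_ex _ H2) as [x [X1 X2]].
  assert (X1' : Rabs (x - L) < Rabs (L - l) / 2) by exact X1.
  assert (X2' : Rabs (x - l) < Rabs (L - l) / 2) by exact X2.
  generalize (Rabs_triang (L - x) (x - l)). replace (L - x + (x - l)) with (L - l) by ring.
  rewrite (Rabs_minus_sym L x). lra.
Qed.

(** The quotient is squeezed between [(rho (f z) - e1) q] and [(rho (f z) + e1) q], where [q] is the
    Euclidean difference quotient, tending to [|l|]; this includes [l = 0]. *)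
Lemma rho_deriv_eq (f : C -> C) (z l : C) :
  (forall w, disk w -> D (f w)) -> disk z -> is_derive f z l ->
  rho_deriv D rho f z = rho (f z) * Cmod l.
Proof.
  intros Hf Hz Hl. apply lim_filtermap_locally'. intros eps Heps.
  assert (Hp : 0 < rho (f z)) by (apply (proj1 Hrho), Hf, Hz).
  generalize (Cmod_ge_0 l); intros Hl0.
  (* [e1] multiplies [q <= |l| + 1] and [e2] multiplies [rho (f z)]; each product is at most
     [eps / 4]. *)
  set (e1 := Rmin 1 (eps / (4 * (Cmod l + 1)))).
  assert (He1 : 0 < e1) by (apply Rmin_pos; [lra|apply Rdiv_lt_0_compat; lra]).
  assert (He1a : e1 <= 1) by apply Rmin_l.
  assert (He1b : e1 * (Cmod l + 1) <= eps / 4).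
  { replace (eps / 4) with (eps / (4 * (Cmod l + 1)) * (Cmod l + 1)) by (field; lra).
    apply Rmult_le_compat_r; [lra|apply Rmin_r]. }
  set (e2 := Rmin 1 (eps / (4 * (rho (f z) + 1)))).
  assert (He2 : 0 < e2) by (apply Rmin_pos; [lra|apply Rdiv_lt_0_compat; lra]).
  assert (He2a : e2 <= 1) by apply Rmin_l.
  assert (He2b : e2 * (rho (f z) + 1) <= eps / 4).
  { replace (eps / 4) with (eps / (4 * (rho (f z) + 1)) * (rho (f z) + 1)) by (field; lra).
    apply Rmult_le_compat_r; [lra|apply Rmin_r]. }
  destruct (rho_dist_local_upper (f z) e1 (Hf z Hz) He1) as [d1 [Hd1 H1]].
  destruct (rho_dist_local_lower (f z) e1 (Hf z Hz) He1) as [d2 [Hd2 H2]].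
  destruct (ex_derive_C_continuous f z (ex_intro _ l Hl) (Rmin d1 d2)) as [d3 [Hd3 H3]];
    [apply Rmin_pos; assumption|].
  destruct (proj1 (is_derive_C f z l) Hl e2 He2) as [d4 [Hd4 H4]].
  exists (Rmin d3 d4). split; [apply Rmin_pos; assumption|]. intros w Hne Hw.
  assert (W3 := H3 w (Rlt_le_trans _ _ _ Hw (Rmin_l _ _))).
  assert (W4 := H4 w (Rlt_le_trans _ _ _ Hw (Rmin_r _ _))).
  destruct (H1 (f z) (f w)) as [_ [_ U]];
    [replace (f z - f z)%C with (RtoC 0) by ring; rewrite Cmod_0; exact Hd1|
     exact (Rlt_le_trans _ _ _ W3 (Rmin_l _ _))|].
  destruct (H2 (f w)) as [_ L]; [exact (Rlt_le_trans _ _ _ W3 (Rmin_r _ _))|].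
  assert (Hn : 0 < Cmod (w - z)).
  { apply Cmod_gt_0. intros E. apply Hne. replace w with (w - z + z)%C by ring. rewrite E. ring. }
  rewrite (Cmod_sub_sym z w). set (n := Cmod (w - z)) in *.
  set (q := Cmod (f w - f z) / n).
  assert (Hq : Rabs (q - Cmod l) <= e2).
  { assert (Ha : Cmod (f w - f z) <= (Cmod l + e2) * n).
    { replace (f w - f z)%C with ((f w - f z - l * (w - z)) + l * (w - z))%C by ring.
      eapply Rle_trans; [apply Cmod_triangle|]. rewrite Cmod_mult. fold n. lra. }
    assert (Hb : (Cmod l - e2) * n <= Cmod (f w - f z)).
    { generalize (Cmod_triangle (f w - f z) (- (f w - f z - l * (w - z)))).
      replace (f w - f z + - (f w - f z - l * (w - z)))%C with (l * (w - z))%C by ring.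
      rewrite Cmod_opp, Cmod_mult. fold n. lra. }
    assert (E : q * n = Cmod (f w - f z)) by (unfold q; field; lra).
    apply Rabs_le. split; apply Rmult_le_reg_r with n; try exact Hn; nra. }
  set (x := rho_dist D rho (f z) (f w) / n).
  assert (Ex : x * n = rho_dist D rho (f z) (f w)) by (unfold x; field; lra).
  assert (Eq : q * n = Cmod (f w - f z)) by (unfold q; field; lra).
  assert (Xu : x <= (rho (f z) + e1) * q) by (apply Rmult_le_reg_r with n; [exact Hn|]; nra).
  assert (Xl : (rho (f z) - e1) * q <= x) by (apply Rmult_le_reg_r with n; [exact Hn|]; nra).
  apply Rabs_le_between in Hq.
  assert (Hq0 : 0 <= q) by (unfold q; apply Rdiv_le_0_compat; [apply Cmod_ge_0|exact Hn]).
  assert (e1 * q <= eps / 4) by nra.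
  assert (Rabs (rho (f z) * (q - Cmod l)) <= eps / 4).
  { rewrite Rabs_mult, (Rabs_pos_eq (rho _)) by lra.
    assert (Rabs (q - Cmod l) <= e2) by (apply Rabs_le; lra). nra. }
  apply Rabs_le_between in H0. apply Rabs_le. nra.
Qed.

End Distance.

(** * From the derivative to the boundary function *)

(* The hypotheses make [b'] an upper bound for the [rho]-speed of [Phi]. *)
Lemma rho_dist_along_curve (D : C -> Prop) (rho : C -> R) (Phi : R -> C) (B : R -> R) (a b : R) :
  metric_on D rho -> plane_domain D -> a < b ->
  (forall t, a <= t <= b -> D (Phi t)) ->
  (forall t, a <= t <= b -> exists v b', 0 <= v /\ rho (Phi t) * v <= b' /\ is_derive B t b' /\
     forall eps, 0 < eps -> exists d, 0 < d /\ forall s, a <= s <= b -> Rabs (s - t) < d ->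
       Cmod (Phi s - Phi t) <= (v + eps) * Rabs (s - t)) ->
  rho_dist D rho (Phi a) (Phi b) <= B b - B a /\ rho_dist D rho (Phi b) (Phi a) <= B b - B a.
Proof.
  intros Hrho HD Hab HPhi Hsp.
  (* The factor [sign (t - s)] makes the last term the increment of [B] from the smaller to the
     larger of [s] and [t]. *)
  assert (Hloc : forall t, a <= t <= b -> forall eps, 0 < eps -> exists d, 0 < d /\
     forall s, a <= s <= b -> Rabs (s - t) < d ->
       (rho_dist D rho (Phi s) (Phi t) <= eps * Rabs (s - t) + (B t - B s) * sign (t - s)) /\
       (rho_dist D rho (Phi t) (Phi s) <= eps * Rabs (s - t) + (B t - B s) * sign (t - s))).
  { intros t Ht eps Heps. destruct (Hsp t Ht) as [v [b' [Hv [Hvb [HB Hd]]]]].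
    assert (Hr : 0 < rho (Phi t)) by (apply (proj1 Hrho), HPhi, Ht).
    (* As [e1 <= 1], [(rho + e1) (v + e1) <= rho v + e1 (rho + v + 1) <= b' + eps / 2]; the other
       [eps / 2] is spent on the difference quotient of [B]. *)
    set (e1 := Rmin 1 (eps / (2 * (rho (Phi t) + v + 1)))).
    assert (He1 : 0 < e1) by (apply Rmin_pos; [lra|apply Rdiv_lt_0_compat; lra]).
    assert (He1a : e1 <= 1) by apply Rmin_l.
    assert (He1b : e1 * (rho (Phi t) + v + 1) <= eps / 2).
    { replace (eps / 2) with (eps / (2 * (rho (Phi t) + v + 1)) * (rho (Phi t) + v + 1))
        by (field; lra).
      apply Rmult_le_compat_r; [lra|apply Rmin_r]. }
    destruct (rho_dist_local_upper D rho Hrho HD (Phi t) e1 (HPhi t Ht) He1) as [d1 [Hd1 H1]].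
    destruct (Hd e1 He1) as [d2 [Hd2 H2]].
    apply is_derive_Reals in HB. destruct (HB (eps / 2)) as [d3 H3]; [lra|].
    assert (Hq : 0 < d1 / (v + 2)) by (apply Rdiv_lt_0_compat; lra).
    exists (Rmin (Rmin d2 d3) (d1 / (v + 2))).
    split; [repeat apply Rmin_pos; try assumption; apply cond_pos|].
    intros s Hs Hst.
    assert (S1 := Rlt_le_trans _ _ _ Hst (Rmin_l _ _)).
    assert (S4 := Rlt_le_trans _ _ _ Hst (Rmin_r _ _)).
    assert (S2 := Rlt_le_trans _ _ _ S1 (Rmin_l _ _)).
    assert (S3 := Rlt_le_trans _ _ _ S1 (Rmin_r _ _)).
    assert (C2 := H2 s Hs S2). generalize (Rabs_pos (s - t)); intros Hp.
    assert (Cn : Cmod (Phi s - Phi t) < d1).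
    { replace d1 with (d1 / (v + 2) * (v + 2)) by (field; lra). nra. }
    assert (C0 : Cmod (Phi t - Phi t) < d1).
    { replace (Phi t - Phi t)%C with (RtoC 0) by ring. rewrite Cmod_0. exact Hd1. }
    destruct (H1 _ _ Cn C0) as [_ [_ U1]]. destruct (H1 _ _ C0 Cn) as [_ [_ U2]].
    rewrite (Cmod_sub_sym (Phi t)) in U1.
    assert (HU : (rho (Phi t) + e1) * Cmod (Phi s - Phi t) <= (b' + eps / 2) * Rabs (s - t)).
    { apply Rle_trans with ((rho (Phi t) + e1) * ((v + e1) * Rabs (s - t))).
      - apply Rmult_le_compat_l; lra.
      - rewrite <- Rmult_assoc. apply Rmult_le_compat_r; [exact Hp|]. nra. }
    assert (HBd : b' * Rabs (s - t) <= eps / 2 * Rabs (s - t) + (B t - B s) * sign (t - s)).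
    { destruct (Req_dec s t) as [E|E].
      - rewrite E. replace (t - t) with 0 by ring. rewrite Rabs_R0, sign_0. lra.
      - assert (Hne : s - t <> 0) by lra.
        specialize (H3 (s - t) Hne S3). replace (t + (s - t)) with s in H3 by ring.
        apply Rabs_def2 in H3. set (q := (B s - B t) / (s - t)) in *.
        assert (Eq : B s - B t = q * (s - t)) by (unfold q; field; exact Hne).
        replace (B t - B s) with (- (q * (s - t))) by lra.
        destruct (Rdichotomy _ _ E) as [Hlt|Hgt].
        + rewrite sign_eq_1, Rabs_left by lra. nra.
        + rewrite sign_eq_m1, Rabs_pos_eq by lra. nra. }
    lra. }
  split; apply Rminus_le.
  - apply (subadditive_interval_nonpos
      (fun s t => rho_dist D rho (Phi s) (Phi t) - (B t - B s))); [exact Hab| |].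
    + intros x y z Hx Hxy Hyz Hz.
      generalize (rho_dist_triangle D rho Hrho HD (Phi x) (Phi y) (Phi z)).
      intros T. assert (T' := T (HPhi x ltac:(lra)) (HPhi y ltac:(lra)) (HPhi z ltac:(lra))). lra.
    + intros t Ht eps Heps. destruct (Hloc t Ht eps Heps) as [d [Hd H]].
      exists d. split; [exact Hd|]. intros s Hs Hst. destruct (H s Hs Hst) as [U1 U2].
      destruct (Req_dec s t) as [E|E].
      { rewrite E in *. replace (t - t) with 0 in * by ring. rewrite Rabs_R0 in *. split; lra. }
      split; intros Hle.
      * rewrite sign_eq_1, Rabs_left in U1 by lra. lra.
      * rewrite sign_eq_m1, Rabs_pos_eq in U2 by lra. lra.
  - apply (subadditive_interval_nonpos
      (fun s t => rho_dist D rho (Phi t) (Phi s) - (B t - B s))); [exact Hab| |].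
    + intros x y z Hx Hxy Hyz Hz.
      generalize (rho_dist_triangle D rho Hrho HD (Phi z) (Phi y) (Phi x)).
      intros T. assert (T' := T (HPhi z ltac:(lra)) (HPhi y ltac:(lra)) (HPhi x ltac:(lra))). lra.
    + intros t Ht eps Heps. destruct (Hloc t Ht eps Heps) as [d [Hd H]].
      exists d. split; [exact Hd|]. intros s Hs Hst. destruct (H s Hs Hst) as [U1 U2].
      destruct (Req_dec s t) as [E|E].
      { rewrite E in *. replace (t - t) with 0 in * by ring. rewrite Rabs_R0 in *. split; lra. }
      split; intros Hle.
      * rewrite sign_eq_1, Rabs_left in U2 by lra. lra.
      * rewrite sign_eq_m1, Rabs_pos_eq in U1 by lra. lra.
Qed.

Lemma Rpower_pos (x y : R) : 0 < Rpower x y.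
Proof. apply exp_pos. Qed.

Lemma Rpower_pred (x a : R) : 0 < x -> Rpower x (a - 1) * x = Rpower x a.
Proof.
  intros Hx. rewrite <- (Rpower_1 x Hx) at 2. rewrite <- Rpower_plus. f_equal. ring.
Qed.

Lemma Rpower_small (a eps : R) : 0 < a -> 0 < eps ->
  exists d, 0 < d /\ forall x, 0 < x < d -> Rpower x a < eps.
Proof.
  intros Ha He. exists (Rpower eps (/ a)). split; [apply Rpower_pos|]. intros x Hx.
  replace eps with (Rpower (Rpower eps (/ a)) a).
  - apply Rlt_Rpower_l; [exact Ha|lra].
  - rewrite Rpower_mult. replace (/ a * a) with 1 by (field; lra). apply Rpower_1, He.
Qed.

(** A primitive of the growth bound. For positive [a] its values near [1] are bounded, the origin of
    [K / alpha] in the radial estimates. *)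
Lemma is_derive_Rpower_boundary (K a t : R) : a <> 0 -> t < 1 ->
  is_derive (fun r => - (K / a) * Rpower (1 - r) a) t (K * Rpower (1 - t) (a - 1)).
Proof.
  intros Ha Ht. unfold Rpower at 1. auto_derive; [lra|].
  change (exp (a * ln (1 + - t))) with (Rpower (1 - t) a).
  rewrite <- (Rpower_pred (1 - t) a) by lra.
  replace (1 + - t) with (1 - t) by ring. field. split; lra.
Qed.

(** The chord has length [2 r |sin ((s - t) / 2)|]. *)
Lemma Cmod_polar_sub (r s t : R) : 0 <= r <= 1 -> Cmod (polar r s - polar r t) <= Rabs (s - t).
Proof.
  intros Hr. set (h := s - t).
  assert (Hs : Rabs (sin (h / 2)) <= Rabs (h / 2)).
  { destruct (Rtotal_order h 0) as [H|[H|H]].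
    - rewrite <- Rabs_Ropp, <- sin_neg, <- (Rabs_Ropp (h / 2)).
      assert (- (h / 2) > 0) by lra. generalize (sin_lt_x (- (h / 2)) H0) (SIN_bound (- (h / 2))).
      rewrite (Rabs_pos_eq (- (h / 2))) by lra. intros.
      destruct (Rle_dec (- (h / 2)) 1).
      + rewrite Rabs_pos_eq; [lra|]. apply sin_ge_0; [lra|]. generalize PI2_1; lra.
      + apply Rabs_le; lra.
    - rewrite H. replace (0 / 2) with 0 by field. rewrite sin_0. lra.
    - assert (h / 2 > 0) by lra. generalize (sin_lt_x (h / 2) H0) (SIN_bound (h / 2)).
      rewrite (Rabs_pos_eq (h / 2)) by lra. intros.
      destruct (Rle_dec (h / 2) 1).
      + rewrite Rabs_pos_eq; [lra|]. apply sin_ge_0; [lra|]. generalize PI2_1; lra.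
      + apply Rabs_le; lra. }
  assert (E : Cmod (polar r s - polar r t) ^ 2 = (2 * r * Rabs (sin (h / 2))) ^ 2).
  { replace ((2 * r * Rabs (sin (h / 2))) ^ 2) with (4 * r ^ 2 * Rabs (sin (h / 2)) ^ 2) by ring.
    rewrite Cmod2_alt, pow2_abs.
    assert (Hc : cos h = 1 - 2 * sin (h / 2) * sin (h / 2)).
    { rewrite <- cos_2a_sin. f_equal. field. }
    unfold h in Hc at 1. rewrite cos_minus in Hc.
    generalize (sin2_cos2 s) (sin2_cos2 t). unfold Rsqr, polar, Re, Im; simpl. intros E1 E2.
    replace ((r * cos s + - (r * cos t)) * ((r * cos s + - (r * cos t)) * 1) +
      (r * sin s + - (r * sin t)) * ((r * sin s + - (r * sin t)) * 1)) with
      (r * r * ((sin s * sin s + cos s * cos s) + (sin t * sin t + cos t * cos t)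
         - 2 * (cos s * cos t + sin s * sin t))) by ring.
    rewrite E1, E2, Hc. ring. }
  assert (H2 : 2 * r * Rabs (sin (h / 2)) <= Rabs h).
  { unfold Rdiv in Hs. rewrite Rabs_mult in Hs. rewrite (Rabs_pos_eq (/ 2)) in Hs by lra.
    generalize (Rabs_pos (sin (h * / 2))). unfold Rdiv. intros. nra. }
  generalize (Cmod_ge_0 (polar r s - polar r t)%C) (Rabs_pos (sin (h / 2))). intros.
  assert (0 <= 2 * r * Rabs (sin (h / 2))) by nra.
  apply Rle_trans with (2 * r * Rabs (sin (h / 2))); [|exact H2].
  apply Rsqr_incr_0; [unfold Rsqr; simpl in E; lra|assumption|assumption].
Qed.

Lemma at_left_1 (P : R -> Prop) :
  at_left 1 P <-> exists r0, 0 <= r0 < 1 /\ forall r, r0 < r < 1 -> P r.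
Proof.
  split.
  - intros [d Hd]. exists (Rmax 0 (1 - d)). generalize (cond_pos d); intros Hp.
    split; [split; [apply Rmax_l|apply Rmax_lub_lt; lra]|].
    intros r Hr. apply Hd; [|lra]. change (Rabs (r - 1) < d).
    generalize (Rmax_r 0 (1 - d)). intros. apply Rabs_def1; lra.
  - intros [r0 [Hr0 H]]. assert (Hp : 0 < 1 - r0) by lra.
    exists (mkposreal _ Hp). intros r Hr Hr1. assert (Hr' : Rabs (r - 1) < 1 - r0) by exact Hr.
    apply Rabs_def2 in Hr'. apply H. lra.
Qed.

Section Forward.

Context (D : C -> Prop) (rho : C -> R) (Hrho : metric_on D rho) (HD : plane_domain D)
  (c : R) (Hc : 0 < c) (Hlb : forall p, D p -> c <= rho p)
  (Hbdry : forall eta : C, D eta ->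
     filterlim (fun zeta => rho_dist D rho zeta eta) (to_boundary D) (Rbar_locally p_infty))
  (f : C -> C) (Hf : analytic_map f D)
  (alpha K r0 : R) (Halpha : 0 < alpha) (HK : 0 <= K) (Hr0 : 0 <= r0 < 1)
  (Hgrowth : forall z l : C, r0 < Cmod z < 1 -> is_derive f z l ->
     rho (f z) * Cmod l <= K * Rpower (1 - Cmod z) (alpha - 1)).

Let d := rho_dist D rho.

(** A 1-Lipschitz [w] need not be smooth: [|f'(w t)|] already bounds the speed of [f o w]. Radii and
    circles are both instances. *)
Lemma rho_dist_along_path (w : R -> C) (B b' : R -> R) (x y : R) : x < y ->
  (forall t, x <= t <= y -> r0 < Cmod (w t) < 1) ->
  (forall s t, Cmod (w s - w t) <= Rabs (s - t)) ->
  (forall t, x <= t <= y -> is_derive B t (b' t)) ->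
  (forall t, x <= t <= y -> K * Rpower (1 - Cmod (w t)) (alpha - 1) <= b' t) ->
  d (f (w x)) (f (w y)) <= B y - B x /\ d (f (w y)) (f (w x)) <= B y - B x.
Proof.
  intros Hxy Hw Hlip HB Hb.
  apply (rho_dist_along_curve D rho (fun t => f (w t)) B x y Hrho HD Hxy).
  - intros t Ht. apply (proj1 Hf). apply Hw, Ht.
  - intros t Ht. destruct (proj2 Hf (w t)) as [l Hl]; [apply Hw, Ht|].
    exists (Cmod l), (b' t). split; [apply Cmod_ge_0|]. split.
    + eapply Rle_trans; [apply (Hgrowth _ _ (Hw t Ht) Hl)|apply Hb, Ht].
    + split; [apply HB, Ht|]. intros eps Heps.
      destruct (proj1 (is_derive_C f (w t) l) Hl eps Heps) as [e [He H]].
      exists e. split; [exact He|]. intros s Hs Hst.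
      assert (Hst' := Hlip s t). specialize (H (w s) (Rle_lt_trans _ _ _ Hst' Hst)).
      replace (f (w s) - f (w t))%C with
        ((f (w s) - f (w t) - l * (w s - w t)) + l * (w s - w t))%C by ring.
      eapply Rle_trans; [apply Cmod_triangle|]. rewrite Cmod_mult.
      apply Rle_trans with ((Cmod l + eps) * Cmod (w s - w t)); [lra|].
      apply Rmult_le_compat_l; [generalize (Cmod_ge_0 l); lra|exact Hst'].
Qed.

Lemma rho_dist_radial (z : C) (r r' : R) : Cmod z = 1 -> r0 < r -> r < r' -> r' < 1 ->
  d (f (r * z)%C) (f (r' * z)%C) <= K / alpha * Rpower (1 - r) alpha /\
  d (f (r' * z)%C) (f (r * z)%C) <= K / alpha * Rpower (1 - r) alpha.
Proof.
  intros Hz Hr Hrr Hr'.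
  assert (Hm : forall t, 0 <= t -> Cmod (t * z) = t).
  { intros t Ht. rewrite Cmod_mult, Hz, Cmod_R, Rabs_pos_eq; lra. }
  assert (H := rho_dist_along_path (fun t => (t * z)%C)
    (fun t => - (K / alpha) * Rpower (1 - t) alpha)
    (fun t => K * Rpower (1 - t) (alpha - 1)) r r' Hrr).
  assert (Hpos : 0 <= K / alpha * Rpower (1 - r') alpha).
  { apply Rmult_le_pos; [apply Rdiv_le_0_compat; lra|left; apply Rpower_pos]. }
  destruct H as [H1 H2].
  - intros t Ht. rewrite Hm by lra. lra.
  - intros s t. replace (s * z - t * z)%C with (RtoC (s - t) * z)%C
      by (rewrite RtoC_minus; ring). rewrite Cmod_mult, Hz, Cmod_R. lra.
  - intros t Ht. apply is_derive_Rpower_boundary; lra.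
  - intros t Ht. rewrite Hm by lra. lra.
  - lra.
Qed.

Lemma rho_dist_angular (r s t : R) : r0 < r < 1 ->
  d (f (polar r s)) (f (polar r t)) <= K * Rpower (1 - r) (alpha - 1) * Rabs (s - t).
Proof.
  intros Hr. set (b := K * Rpower (1 - r) (alpha - 1)).
  assert (H : forall x y, x < y -> d (f (polar r x)) (f (polar r y)) <= b * y - b * x /\
     d (f (polar r y)) (f (polar r x)) <= b * y - b * x).
  { intros x y Hxy. apply (rho_dist_along_path (polar r) (fun t => b * t) (fun _ => b)); [exact Hxy| | | |].
    - intros u _. rewrite Cmod_polar by lra. exact Hr.
    - intros u v. apply Cmod_polar_sub. lra.
    - intros u _. auto_derive; [exact I|ring].
    - intros u _. rewrite Cmod_polar by lra. right; reflexivity. }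
  destruct (Rtotal_order s t) as [Hlt|[E|Hgt]].
  - rewrite Rabs_left by lra. generalize (proj1 (H s t Hlt)). lra.
  (* The path estimate needs distinct parameters; that [d p p <= 0] comes from
     [rho_dist_local_upper] at coinciding points. *)
  - rewrite E. replace (t - t) with 0 by ring. rewrite Rabs_R0.
    apply le_epsilon. intros e He.
    assert (Dp : D (f (polar r t))).
    { apply (proj1 Hf). unfold disk. rewrite Cmod_polar; lra. }
    destruct (rho_dist_local_upper D rho Hrho HD _ 1 Dp Rlt_0_1) as [d1 [Hd1 H1]].
    assert (E0 : (f (polar r t) - f (polar r t))%C = RtoC 0) by ring.
    destruct (H1 (f (polar r t)) (f (polar r t))) as [_ [_ U]];
      [rewrite E0, Cmod_0; exact Hd1|rewrite E0, Cmod_0; exact Hd1|].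
    rewrite E0, Cmod_0 in U. unfold d. lra.
  - rewrite Rabs_pos_eq by lra. generalize (proj2 (H t s Hgt)). lra.
Qed.

Lemma euclidean_le_rho_dist (z w : C) : D z -> D w -> Cmod (w - z) <= d z w / c.
Proof.
  intros Hz Hw. apply Rmult_le_reg_l with c; [exact Hc|].
  replace (c * (d z w / c)) with (d z w) by (field; lra).
  apply rho_dist_ge_euclidean; auto. lra.
Qed.

Lemma image_radial_in_domain (z : C) (r : R) : Cmod z = 1 -> 0 <= r < 1 -> D (f (r * z)%C).
Proof.
  intros Hz Hr. apply (proj1 Hf). unfold disk. rewrite Cmod_mult, Hz, Cmod_R, Rabs_pos_eq; lra.
Qed.

Lemma radial_limit (z : C) : Cmod z = 1 -> exists L : C,
  forall eps, 0 < eps -> exists r1, r0 < r1 < 1 /\ forall r, r1 < r < 1 ->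
    Cmod (f (r * z)%C - L) < eps.
Proof.
  intros Hz.
  assert (Hcau : forall eps, 0 < eps -> exists r1, r0 < r1 < 1 /\
     forall r r', r1 < r < 1 -> r1 < r' < 1 -> Cmod (f (r' * z)%C - f (r * z)%C) < eps).
  { intros eps Heps.
    assert (HA : 0 <= K / alpha) by (apply Rdiv_le_0_compat; lra).
    (* The [+ 1] keeps the denominator positive when [K = 0]. *)
    destruct (Rpower_small alpha (eps * c / (K / alpha + 1))) as [e [He H]];
      [exact Halpha|apply Rdiv_lt_0_compat; nra|].
    exists (Rmax ((1 + r0) / 2) (1 - e)). split.
    { split; [apply Rlt_le_trans with ((1 + r0) / 2); [lra|apply Rmax_l]|].
      apply Rmax_lub_lt; lra. }
    intros r r' Hr Hr'.
    generalize (Rmax_l ((1 + r0) / 2) (1 - e)) (Rmax_r ((1 + r0) / 2) (1 - e)); intros M1 M2.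
    assert (Hb : forall u v, Rmax ((1 + r0) / 2) (1 - e) < u -> u < v -> v < 1 ->
       d (f (u * z)%C) (f (v * z)%C) / c < eps).
    { intros u v Hu Huv Hv. destruct (rho_dist_radial z u v) as [Hd _]; [exact Hz|lra|lra|lra|].
      apply Rmult_lt_reg_r with c; [exact Hc|].
      replace (d (f (u * z)%C) (f (v * z)%C) / c * c) with (d (f (u * z)%C) (f (v * z)%C))
        by (field; lra).
      assert (Hs := H (1 - u) ltac:(lra)). generalize (Rpower_pos (1 - u) alpha); intros.
      apply Rle_lt_trans with (1 := Hd).
      apply Rle_lt_trans with ((K / alpha + 1) * Rpower (1 - u) alpha - Rpower (1 - u) alpha);
        [lra|].
      replace (eps * c) with ((K / alpha + 1) * (eps * c / (K / alpha + 1))) by (field; lra).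
      apply Rlt_trans with ((K / alpha + 1) * Rpower (1 - u) alpha); [lra|].
      apply Rmult_lt_compat_l; lra. }
    destruct (Rtotal_order r r') as [Hlt|[E|Hgt]].
    - eapply Rle_lt_trans; [apply euclidean_le_rho_dist|apply Hb; lra];
        apply image_radial_in_domain; lra || exact Hz.
    - rewrite E. replace (f (r' * z)%C - f (r' * z)%C)%C with (RtoC 0) by ring.
      rewrite Cmod_0. exact Heps.
    - rewrite Cmod_sub_sym. eapply Rle_lt_trans; [apply euclidean_le_rho_dist|apply Hb; lra];
        apply image_radial_in_domain; lra || exact Hz. }
  (* Completeness of the reals is applied to each coordinate, with [pr] standing for [Re] and
     [Im]. *)
  assert (Hpart : forall pr : C -> R, (forall z w, pr (z - w)%C = pr z - pr w) ->
     (forall z, Rabs (pr z) <= Cmod z) -> exists l, forall eps, 0 < eps ->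
       exists r1, r0 < r1 < 1 /\ forall r, r1 < r < 1 -> Rabs (pr (f (r * z)%C) - l) < eps).
  { intros pr Hsub Hle.
    destruct (proj1 (filterlim_locally_cauchy (U := R_CompleteSpace) (F := at_left 1)
      (fun r => pr (f (r * z)%C)))) as [l Hl].
    - intros eps. destruct (Hcau eps (cond_pos eps)) as [r1 [Hr1 H]].
      exists (fun r => r1 < r < 1). split.
      + apply at_left_1. exists r1. split; [lra|auto].
      + intros u v Hu Hv. change (Rabs (pr (f (v * z)%C) - pr (f (u * z)%C)) < eps).
        rewrite <- Hsub. eapply Rle_lt_trans; [apply Hle|]. auto.
    - exists l. intros eps Heps.
      assert (Hb : at_left 1 (fun r => Rabs (pr (f (r * z)%C) - l) < eps)).
      { apply (Hl (fun v => Rabs (v - l) < eps)).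
        exists (mkposreal _ Heps). intros v Hv. exact Hv. }
      apply at_left_1 in Hb. destruct Hb as [r1 [Hr1 H]].
      exists (Rmax r1 ((1 + r0) / 2)). split.
      + split; [apply Rlt_le_trans with ((1 + r0) / 2); [lra|apply Rmax_r]|].
        apply Rmax_lub_lt; lra.
      + intros r Hr. apply H. generalize (Rmax_l r1 ((1 + r0) / 2)). lra. }
  destruct (Hpart Re) as [x Hx]; [intros; unfold Re; simpl; ring|apply re_le_Cmod|].
  destruct (Hpart Im) as [y Hy]; [intros; unfold Im; simpl; ring|
    intros v; eapply Rle_trans; [apply Rmax_r|apply Rmax_Cmod]|].
  exists (x, y). intros eps Heps.
  destruct (Hx (eps / 2)) as [r1 [Hr1 H1]]; [lra|].
  destruct (Hy (eps / 2)) as [r2 [Hr2 H2]]; [lra|].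
  exists (Rmax r1 r2). split.
  - split; [apply Rlt_le_trans with r1; [lra|apply Rmax_l]|apply Rmax_lub_lt; lra].
  - intros r Hr. generalize (Rmax_l r1 r2) (Rmax_r r1 r2); intros.
    eapply Rle_lt_trans; [apply Cmod_le_abs|].
    assert (A1 := H1 r ltac:(lra)). assert (A2 := H2 r ltac:(lra)).
    unfold Re, Im in *. simpl. unfold Rminus in *. lra.
Qed.

(* A radial limit outside [D] would be a boundary point at bounded distance
   from [f (r z)]. *)
Lemma radial_limit_in_domain (z L : C) : Cmod z = 1 ->
  (forall eps, 0 < eps -> exists r1, r0 < r1 < 1 /\ forall r, r1 < r < 1 ->
    Cmod (f (r * z)%C - L) < eps) -> D L.
Proof.
  intros Hz HL. apply NNPP; intros HN.
  set (r := (1 + r0) / 2). set (M := K / alpha * Rpower (1 - r) alpha).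
  assert (Deta : D (f (r * z)%C)) by (apply image_radial_in_domain; [exact Hz|unfold r; lra]).
  assert (Hfar := Hbdry _ Deta (fun x => M < x) (ex_intro _ M (fun x H => H))).
  specialize (Hfar (Some L)).
  assert (Hb : ext_boundary D (Some L)).
  { intros P HP. apply locally_Cmod in HP. destruct HP as [e [He HP]]. split.
    - destruct (HL e He) as [r1 [Hr1 H]]. exists (Some (f (((1 + r1) / 2)%R * z)%C)). split.
      + apply HP, H. lra.
      + apply image_radial_in_domain; [exact Hz|lra].
    - exists (Some L). split; [|exact HN]. apply HP.
      replace (L - L)%C with (RtoC 0) by ring. rewrite Cmod_0. exact He. }
  specialize (Hfar Hb). simpl in Hfar. apply locally_Cmod in Hfar.
  destruct Hfar as [e [He Hfar]]. destruct (HL e He) as [r1 [Hr1 H]].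
  set (r' := Rmax ((1 + r1) / 2) ((1 + r) / 2)).
  assert (B1 : (1 + r1) / 2 <= r') by apply Rmax_l.
  assert (B2 : (1 + r) / 2 <= r') by apply Rmax_r.
  assert (B3 : r' < 1) by (apply Rmax_lub_lt; unfold r; lra).
  assert (Hf1 := Hfar (f (r' * z)%C) (H r' ltac:(lra))).
  specialize (Hf1 (image_radial_in_domain z r' Hz ltac:(lra))).
  destruct (rho_dist_radial z r r') as [_ H2]; [exact Hz|unfold r; lra|unfold r in *; lra|lra|].
  unfold d in H2. fold M in H2. lra.
Qed.

(** Lets the outer radius tend to [1] in [rho_dist_radial]. Since [L] lies in [D], Euclidean
    convergence to [L] is also convergence in [d]. *)
Lemma radial_limit_spec (z L : C) : Cmod z = 1 ->
  (forall eps, 0 < eps -> exists r1, r0 < r1 < 1 /\ forall r, r1 < r < 1 ->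
    Cmod (f (r * z)%C - L) < eps) ->
  forall r, r0 < r < 1 ->
    d (f (r * z)%C) L <= K / alpha * Rpower (1 - r) alpha /\
    d L (f (r * z)%C) <= K / alpha * Rpower (1 - r) alpha.
Proof.
  intros Hz HL r Hr. assert (DL := radial_limit_in_domain z L Hz HL).
  assert (Happrox : forall e, 0 < e -> exists r', r < r' < 1 /\
     d (f (r' * z)%C) L <= e /\ d L (f (r' * z)%C) <= e).
  { intros e He.
    destruct (rho_dist_local_upper D rho Hrho HD L 1 DL Rlt_0_1) as [d1 [Hd1 H1]].
    assert (Hrp : 0 < rho L) by (apply (proj1 Hrho), DL).
    assert (Hq : 0 < e / (rho L + 1)) by (apply Rdiv_lt_0_compat; lra).
    destruct (HL (Rmin d1 (e / (rho L + 1)))) as [r1 [Hr1 H]]; [apply Rmin_pos; assumption|].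
    set (r' := Rmax ((1 + r1) / 2) ((1 + r) / 2)).
    assert (B1 : (1 + r1) / 2 <= r') by apply Rmax_l.
    assert (B2 : (1 + r) / 2 <= r') by apply Rmax_r.
    assert (B3 : r' < 1) by (apply Rmax_lub_lt; lra).
    assert (Hn := H r' ltac:(lra)).
    assert (N1 := Rlt_le_trans _ _ _ Hn (Rmin_l _ _)).
    assert (N2 := Rlt_le_trans _ _ _ Hn (Rmin_r _ _)).
    assert (N0 : Cmod (L - L) < d1).
    { replace (L - L)%C with (RtoC 0) by ring. rewrite Cmod_0. exact Hd1. }
    exists r'. split; [lra|].
    destruct (H1 _ _ N1 N0) as [_ [_ U1]]. destruct (H1 _ _ N0 N1) as [_ [_ U2]].
    rewrite Cmod_sub_sym in U1.
    assert ((rho L + 1) * Cmod (f (r' * z)%C - L) <= e).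
    { replace e with ((rho L + 1) * (e / (rho L + 1))) by (field; lra).
      apply Rmult_le_compat_l; lra. }
    unfold d; lra. }
  assert (Dr : forall u, 0 <= u < 1 -> D (f (u * z)%C)) by (intros; apply image_radial_in_domain; auto).
  split; apply le_epsilon; intros e He; destruct (Happrox e He) as [r' [Hr' [A1 A2]]];
    destruct (rho_dist_radial z r r') as [R1 R2]; try lra; try exact Hz.
  - generalize (rho_dist_triangle D rho Hrho HD (f (r * z)%C) (f (r' * z)%C) L
      (Dr r ltac:(lra)) (Dr r' ltac:(lra)) DL). unfold d in *. lra.
  - generalize (rho_dist_triangle D rho Hrho HD L (f (r' * z)%C) (f (r * z)%C)
      DL (Dr r' ltac:(lra)) (Dr r ltac:(lra))). unfold d in *. lra.
Qed.

Lemma boundary_extension : exists F : C -> C,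
  (forall z, disk z -> F z = f z) /\
  (forall z, Cmod z = 1 -> D (F z)) /\
  (forall z r, Cmod z = 1 -> r0 < r < 1 ->
     d (f (r * z)%C) (F z) <= K / alpha * Rpower (1 - r) alpha /\
     d (F z) (f (r * z)%C) <= K / alpha * Rpower (1 - r) alpha).
Proof.
  assert (Hex : forall z, exists L, Cmod z = 1 -> forall eps, 0 < eps ->
     exists r1, r0 < r1 < 1 /\ forall r, r1 < r < 1 -> Cmod (f (r * z)%C - L) < eps).
  { intros z. destruct (Req_dec (Cmod z) 1) as [E|E].
    - destruct (radial_limit z E) as [L H]. exists L. auto.
    (* Off the circle the condition is void and [0] is a dummy that makes the choice total. *)
    - exists 0%C. intros; contradiction. }
  destruct (functional_choice _ Hex) as [lims Hl].
  exists (fun z => if Rlt_dec (Cmod z) 1 then f z else lims z).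
  assert (Hb : forall z, Cmod z = 1 -> (if Rlt_dec (Cmod z) 1 then f z else lims z) = lims z).
  { intros z Hz. destruct (Rlt_dec (Cmod z) 1); [lra|reflexivity]. }
  split; [|split].
  - intros z Hz. destruct (Rlt_dec (Cmod z) 1); [reflexivity|contradiction].
  - intros z Hz. rewrite Hb by exact Hz. apply (radial_limit_in_domain z); auto.
  - intros z r Hz Hr. rewrite Hb by exact Hz. apply (radial_limit_spec z); auto.
Qed.

(** The radial bound is uniform in the direction, so near a boundary point [F] is close to
    [w |-> f (r w)] for a fixed [r], which is continuous there. *)
Lemma boundary_extension_continuous (F : C -> C) :
  (forall z, disk z -> F z = f z) -> (forall z, Cmod z = 1 -> D (F z)) ->
  (forall z r, Cmod z = 1 -> r0 < r < 1 ->
     d (f (r * z)%C) (F z) <= K / alpha * Rpower (1 - r) alpha /\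
     d (F z) (f (r * z)%C) <= K / alpha * Rpower (1 - r) alpha) ->
  continuous_on closed_disk F.
Proof.
  intros HF HFD HFd. apply continuous_on_C. intros z Hz eps Heps.
  assert (HA : 0 <= K / alpha) by (apply Rdiv_le_0_compat; lra).
  destruct (Rle_lt_or_eq_dec _ _ Hz) as [Hin|Hon].
  - destruct (ex_derive_C_continuous f z (proj2 Hf z Hin) eps Heps) as [e [He H]].
    exists (Rmin e (1 - Cmod z)). split; [apply Rmin_pos; lra|]. intros w _ Hw.
    assert (W1 := Rlt_le_trans _ _ _ Hw (Rmin_l _ _)).
    assert (W2 := Rlt_le_trans _ _ _ Hw (Rmin_r _ _)).
    rewrite (HF z Hin), HF; [auto|]. unfold disk.
    generalize (Cmod_triangle (w - z) z). replace (w - z + z)%C with w by ring. lra.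
  - assert (Hnear : forall w r, closed_disk w -> 0 < r < 1 -> r0 < r * Cmod w ->
       Cmod (F w - f (r * w)%C) <= K / alpha * Rpower (1 - r * Cmod w) alpha / c).
    { intros w r Hw Hr Hrw. set (m := Cmod w) in *.
      assert (Hm : 0 < m) by nra.
      set (u := (w / RtoC m)%C).
      assert (Hm0 : RtoC m <> 0%C) by (intros E; apply RtoC_inj in E; lra).
      assert (Hu : Cmod u = 1).
      { unfold u. rewrite Cmod_div, Cmod_R, Rabs_pos_eq by (exact Hm0 || lra). fold m. field. lra. }
      assert (Ew : w = (m * u)%C) by (unfold u; field; exact Hm0).
      assert (Erw : (r * w)%C = ((r * m)%R * u)%C) by (rewrite Ew, RtoC_mult; ring).
      rewrite Erw. unfold closed_disk in Hw. fold m in Hw.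
      assert (Drm : D (f ((r * m)%R * u)%C)) by (apply image_radial_in_domain; [exact Hu|nra]).
      assert (Hd : D (F w) /\ d (f ((r * m)%R * u)%C) (F w) <= K / alpha * Rpower (1 - r * m) alpha).
      { destruct (Rle_lt_or_eq_dec _ _ Hw) as [Hlt|E1].
        - assert (Hdw : disk w) by exact Hlt. rewrite HF by exact Hdw.
          split; [apply (proj1 Hf), Hdw|]. rewrite Ew.
          apply rho_dist_radial; [exact Hu|lra|nra|exact Hlt].
        - assert (Ewu : w = u) by (rewrite Ew, E1; ring).
          rewrite Ewu. split; [apply HFD, Hu|]. apply HFd; [exact Hu|]. nra. }
      destruct Hd as [Dw Hd]. eapply Rle_trans; [apply euclidean_le_rho_dist; [exact Drm|exact Dw]|].
      unfold Rdiv at 1 3. apply Rmult_le_compat_r; [left; apply Rinv_0_lt_compat, Hc|exact Hd]. }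
    destruct (Rpower_small alpha (eps / 3 * c / (K / alpha + 1))) as [e [He Hsm]];
      [exact Halpha|apply Rdiv_lt_0_compat; nra|].
    assert (Hsmall : forall x, 0 < x < e -> K / alpha * Rpower x alpha / c < eps / 3).
    { intros x Hx. specialize (Hsm x Hx). generalize (Rpower_pos x alpha); intros.
      apply Rmult_lt_reg_r with c; [exact Hc|].
      replace (K / alpha * Rpower x alpha / c * c) with (K / alpha * Rpower x alpha) by (field; lra).
      apply Rlt_trans with ((K / alpha + 1) * Rpower x alpha); [lra|].
      replace (eps / 3 * c) with ((K / alpha + 1) * (eps / 3 * c / (K / alpha + 1))) by (field; lra).
      apply Rmult_lt_compat_l; lra. }
    (* [1 - r] and [1 - |w|] each take at most a third of [e] and of [1 - r0], so [1 - r |w| < e]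
       and [r |w| > r0], as [Hsmall] and [Hnear] require. *)
    set (r := Rmax (1 - e / 3) ((2 + r0) / 3)).
    assert (R1 : 1 - e / 3 <= r) by apply Rmax_l.
    assert (R2 : (2 + r0) / 3 <= r) by apply Rmax_r.
    assert (R3 : r < 1) by (apply Rmax_lub_lt; lra).
    assert (Hdr : disk (r * z)%C).
    { unfold disk. rewrite Cmod_mult, Hon, Cmod_R, Rabs_pos_eq; lra. }
    destruct (ex_derive_C_continuous f (r * z)%C (proj2 Hf _ Hdr) (eps / 3)) as [e1 [He1 H1]]; [lra|].
    set (e2 := Rmin (e / 3) ((1 - r0) / 3)).
    assert (He2 : 0 < e2) by (apply Rmin_pos; lra).
    assert (E2a : e2 <= e / 3) by apply Rmin_l. assert (E2b : e2 <= (1 - r0) / 3) by apply Rmin_r.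
    exists (Rmin e1 e2). split; [apply Rmin_pos; assumption|]. intros w Hw Hwz.
    assert (W1 := Rlt_le_trans _ _ _ Hwz (Rmin_l _ _)).
    assert (W2 := Rlt_le_trans _ _ _ Hwz (Rmin_r _ _)).
    assert (Hwm : 1 - e2 < Cmod w).
    { generalize (Cmod_triangle (z - w) w). replace (z - w + w)%C with z by ring.
      rewrite (Cmod_sub_sym z w), Hon. lra. }
    unfold closed_disk in Hw.
    assert (N1 := Hnear w r Hw ltac:(lra) ltac:(nra)).
    assert (N2 := Hnear z r Hz ltac:(lra) ltac:(rewrite Hon; lra)).
    assert (S1 := Hsmall (1 - r * Cmod w) ltac:(nra)).
    assert (S2 := Hsmall (1 - r * Cmod z) ltac:(rewrite Hon; lra)).
    assert (N3 : Cmod (f (r * w)%C - f (r * z)%C) < eps / 3).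
    { apply H1. replace (r * w - r * z)%C with (r * (w - z))%C by ring.
      rewrite Cmod_mult, Cmod_R, Rabs_pos_eq by lra.
      generalize (Cmod_ge_0 (w - z)%C). nra. }
    replace (F w - F z)%C with
      ((F w - f (r * w)) + ((f (r * w) - f (r * z)) + - (F z - f (r * z))))%C by ring.
    eapply Rle_lt_trans; [apply Cmod_triangle|].
    eapply Rle_lt_trans; [apply Rplus_le_compat_l, Cmod_triangle|]. rewrite Cmod_opp. lra.
Qed.

(** Going to depth exactly [h] balances the legs: [K / alpha] for each radial one and [K] for the
    arc, all times [h^alpha]. *)
Lemma boundary_function_holder (F : C -> C) (s t h : R) :
  (forall z, Cmod z = 1 -> D (F z)) ->
  (forall z r, Cmod z = 1 -> r0 < r < 1 ->
     d (f (r * z)%C) (F z) <= K / alpha * Rpower (1 - r) alpha /\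
     d (F z) (f (r * z)%C) <= K / alpha * Rpower (1 - r) alpha) ->
  0 < h < 1 - r0 -> Rabs (s - t) < h ->
  d (F (polar 1 t)) (F (polar 1 s)) <= (2 * (K / alpha) + K) * Rpower h alpha.
Proof.
  intros HFD HFd Hh Hst.
  assert (Hp : forall u, Cmod (polar 1 u) = 1) by (intros; apply Cmod_polar; lra).
  assert (Hm : forall u, ((1 - h)%R * polar 1 u)%C = polar (1 - h) u).
  { intros u. unfold polar, RtoC, Cmult; simpl. f_equal; ring. }
  assert (Hr : r0 < 1 - h < 1) by lra.
  assert (Dp : forall u, D (f (polar (1 - h) u))).
  { intros u. apply (proj1 Hf). unfold disk. rewrite Cmod_polar; lra. }
  destruct (HFd (polar 1 t) (1 - h) (Hp t) Hr) as [_ A1].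
  destruct (HFd (polar 1 s) (1 - h) (Hp s) Hr) as [A2 _].
  rewrite Hm in A1, A2. replace (1 - (1 - h)) with h in A1, A2 by ring.
  assert (A3 := rho_dist_angular (1 - h) t s Hr). replace (1 - (1 - h)) with h in A3 by ring.
  assert (A4 : K * Rpower h (alpha - 1) * Rabs (t - s) <= K * Rpower h alpha).
  { rewrite <- (Rpower_pred h alpha) by lra. rewrite Rmult_assoc.
    apply Rmult_le_compat_l; [exact HK|]. apply Rmult_le_compat_l; [left; apply Rpower_pos|].
    rewrite Rabs_minus_sym. lra. }
  generalize (rho_dist_triangle D rho Hrho HD _ _ _ (HFD _ (Hp t)) (Dp t) (HFD _ (Hp s)))
    (rho_dist_triangle D rho Hrho HD _ _ _ (Dp t) (Dp s) (HFD _ (Hp s))).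
  unfold d in *. lra.
Qed.

End Forward.

(** * Explicit bounds behind the asymptotic conditions, and the equivalence *)

Lemma inf_metric_lower_bound (D : C -> Prop) (rho : C -> R) :
  Rbar_lt (Finite 0) (inf_metric D rho) -> exists c, 0 < c /\ forall p, D p -> c <= rho p.
Proof.
  unfold inf_metric. intros H.
  destruct (Glb_Rbar_correct (fun r => exists z, D z /\ r = rho z)) as [Hlb _].
  destruct (Glb_Rbar _) as [r| |]; simpl in H.
  - exists r. split; [exact H|]. intros p Hp. apply (Hlb (rho p)). exists p; auto.
  (* An infinite infimum leaves no point in [D], so [1] is a vacuous bound. *)
  - exists 1. split; [lra|]. intros p Hp. destruct (Hlb (rho p)). exists p; auto.
  - contradiction.
Qed.

Lemma boundary_function_polar (F : C -> C) (t : R) : boundary_function F t = F (polar 1 t).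
Proof. unfold boundary_function, polar. rewrite !Rmult_1_l. reflexivity. Qed.

(** Trades [rho_deriv] for the Euclidean derivative, in the form of the hypothesis [Hgrowth] above;
    [Rmax 0 K] makes the constant nonnegative. *)
Lemma big_O_to_circle (D : C -> Prop) (rho : C -> R) (f : C -> C) (alpha : R) :
  metric_on D rho -> plane_domain D -> analytic_map f D ->
  big_O to_circle (fun z => Finite (rho_deriv D rho f z))
        (fun z => Rpower (1 - Cmod z) (alpha - 1)) <->
  exists K r0, 0 <= K /\ 0 <= r0 < 1 /\ forall z l : C, r0 < Cmod z < 1 -> is_derive f z l ->
     rho (f z) * Cmod l <= K * Rpower (1 - Cmod z) (alpha - 1).
Proof.
  intros Hrho HD Hf. split.
  - intros [K HK]. apply at_left_1 in HK. destruct HK as [r0 [Hr0 HK]].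
    exists (Rmax 0 K), r0. split; [apply Rmax_l|]. split; [exact Hr0|]. intros z l Hz Hl.
    specialize (HK (Cmod z) Hz z eq_refl). simpl in HK.
    rewrite (rho_deriv_eq D rho Hrho HD f z l) in HK;
      [|exact (proj1 Hf)|unfold disk; lra|exact Hl].
    generalize (Rpower_pos (1 - Cmod z) (alpha - 1)); intros Hp.
    rewrite (Rabs_pos_eq (Rpower _ _)) in HK by lra.
    eapply Rle_trans; [apply Rle_abs|]. eapply Rle_trans; [exact HK|].
    apply Rmult_le_compat_r; [lra|apply Rmax_r].
  - intros [K [r0 [HK [Hr0 H]]]]. exists K. apply at_left_1. exists r0. split; [exact Hr0|].
    intros r Hr z Hz. simpl. rewrite <- Hz in Hr.
    destruct (proj2 Hf z) as [l Hl]; [unfold disk; lra|].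
    rewrite (rho_deriv_eq D rho Hrho HD f z l); [|exact (proj1 Hf)|unfold disk; lra|exact Hl].
    assert (Hp : 0 < rho (f z)) by (apply (proj1 Hrho), (proj1 Hf); unfold disk; lra).
    rewrite Rabs_pos_eq by (apply Rmult_le_pos; [lra|apply Cmod_ge_0]).
    rewrite Rabs_pos_eq by (left; apply Rpower_pos). apply H; assumption.
Qed.

Lemma at_right_0 (P : R -> Prop) :
  at_right 0 P <-> exists d, 0 < d /\ forall h, 0 < h < d -> P h.
Proof.
  split.
  - intros [d Hd]. exists d. split; [apply cond_pos|]. intros h Hh. apply Hd; [|lra].
    change (Rabs (h - 0) < d). rewrite Rminus_0_r, Rabs_pos_eq; lra.
  - intros [d [Hd H]]. exists (mkposreal _ Hd). intros h Hh Hh0. apply H.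
    assert (Hh' : Rabs (h - 0) < d) by exact Hh. rewrite Rminus_0_r in Hh'.
    generalize (Rle_abs h). lra.
Qed.

(** For [h > 0] the supremum runs over an inhabited set of nonnegative numbers, so it is not minus
    infinity and the absolute value changes nothing. *)
Lemma modulus_le_iff (D : C -> Prop) (rho : C -> R) (phi : R -> C) (h B : R) :
  metric_on D rho -> plane_domain D -> (forall t, D (phi t)) -> 0 < h ->
  Rbar_le (Rbar_abs (modulus D rho phi h)) (Finite B) <->
  forall s t, Rabs (s - t) < h -> rho_dist D rho (phi t) (phi s) <= B.
Proof.
  intros Hrho HD Hphi Hh. unfold modulus.
  set (E := fun x => exists s t : R, Rabs (s - t) < h /\ x = rho_dist D rho (phi t) (phi s)).
  destruct (Lub_Rbar_correct E) as [Hub Hlub].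
  assert (H0 : E (rho_dist D rho (phi 0) (phi 0))).
  { exists 0, 0. split; [|reflexivity]. replace (0 - 0) with 0 by ring. rewrite Rabs_R0. exact Hh. }
  assert (Hn := rho_dist_nonneg D rho Hrho HD (phi 0) (phi 0) (Hphi 0) (Hphi 0)).
  split.
  - intros H s t Hst. assert (Hx : E (rho_dist D rho (phi t) (phi s))) by (exists s, t; auto).
    specialize (Hub _ Hx). destruct (Lub_Rbar E) as [r| |]; simpl in *; [|contradiction|contradiction].
    generalize (Rle_abs r). lra.
  - intros H. specialize (Hub _ H0).
    assert (Hle : Rbar_le (Lub_Rbar E) (Finite B)).
    { apply Hlub. intros x [s [t [Hst ->]]]. apply H, Hst. }
    destruct (Lub_Rbar E) as [r| |]; simpl in *; [|contradiction|contradiction].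
    rewrite Rabs_pos_eq; lra.
Qed.

Lemma extension_in_domain (D : C -> Prop) (f F : C -> C) :
  analytic_map f D -> (forall z, disk z -> F z = f z) ->
  (forall t, D (boundary_function F t)) -> forall z, closed_disk z -> D (F z).
Proof.
  intros Hf HF Hb z Hz. destruct (Rle_lt_or_eq_dec _ _ Hz) as [Hin|Hon].
  - rewrite HF by exact Hin. apply (proj1 Hf), Hin.
  - destruct (polar_exists z) as [t Ht]. rewrite Ht, Hon, <- boundary_function_polar. apply Hb.
Qed.

Lemma metric_bounded_on_closed_disk (D : C -> Prop) (rho : C -> R) (F : C -> C) :
  metric_on D rho -> continuous_on closed_disk F -> (forall z, closed_disk z -> D (F z)) ->
  exists M, forall z, closed_disk z -> rho (F z) <= M.
Proof.
  intros Hrho Hc HF. destruct (closed_disk_max (fun z => rho (F z))) as [z0 [_ H]];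
    [|exists (rho (F z0)); exact H].
  apply continuous_on_R. intros z Hz eps Heps.
  destruct (metric_on_continuous D rho Hrho (F z) (HF z Hz) eps Heps) as [d [Hd H]].
  destruct (proj1 (continuous_on_C closed_disk F) Hc z Hz d Hd) as [d' [Hd' H']].
  exists d'. split; [exact Hd'|]. intros w Hw Hwz. apply H; auto.
Qed.

Theorem theorem4p1 (D : C -> Prop) (rho : C -> R)
    (HD : plane_domain D) (Hrho : metric_on D rho)
    (Hinf : Rbar_lt (Finite 0) (inf_metric D rho))
    (Hbdry : forall eta : C, D eta ->
       filterlim (fun zeta => rho_dist D rho zeta eta)
         (to_boundary D) (Rbar_locally p_infty))
    (alpha : R) (Halpha : 0 < alpha <= 1)
    (f : C -> C) (Hf : analytic_map f D) :
  big_O to_circle (fun z => Finite (rho_deriv D rho f z))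
        (fun z => Rpower (1 - Cmod z) (alpha - 1))
  <->
  exists F : C -> C,
    continuous_extension f F /\
    rho_Lambda D rho alpha (boundary_function F).
Proof.
  destruct (inf_metric_lower_bound D rho Hinf) as [c [Hc Hlb]].
  assert (Ha : 0 < alpha) by apply Halpha.
  rewrite (big_O_to_circle D rho f alpha Hrho HD Hf). split.
  - intros [K [r0 [HK [Hr0 Hgrowth]]]].
    destruct (boundary_extension D rho Hrho HD c Hc Hlb Hbdry f Hf alpha K r0 Ha HK Hr0 Hgrowth)
      as [F [HF [HFD HFd]]].
    exists F. split; [split; [exact HF|]|split; [|split]].
    + exact (boundary_extension_continuous D rho Hrho HD c Hc Hlb f Hf alpha K r0 Ha HK Hr0
        Hgrowth F HF HFD HFd).
    + intros t. unfold boundary_function. rewrite cos_plus, sin_plus, cos_2PI, sin_2PI.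
      do 2 f_equal; ring.
    + intros t. rewrite boundary_function_polar. apply HFD. apply Cmod_polar; lra.
    + exists (2 * (K / alpha) + K). apply at_right_0. exists (1 - r0). split; [lra|].
      intros h Hh. apply modulus_le_iff; [exact Hrho|exact HD| |lra|].
      { intros t. rewrite boundary_function_polar. apply HFD. apply Cmod_polar; lra. }
      intros s t Hst. rewrite !boundary_function_polar.
      rewrite Rabs_pos_eq by (left; apply Rpower_pos).
      exact (boundary_function_holder D rho Hrho HD f Hf alpha K r0 HK Hr0 Hgrowth F s t h
        HFD HFd Hh Hst).
  - intros [F [[HF HFc] [_ [Hb [K HK]]]]].
    apply at_right_0 in HK. destruct HK as [d [Hd HK]].
    assert (HFD := extension_in_domain D f F Hf HF Hb).
    destruct (metric_bounded_on_closed_disk D rho F Hrho HFc HFD) as [M HM].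
    assert (HM0 : 0 < M).
    { assert (H0 : closed_disk 0) by (unfold closed_disk; rewrite Cmod_0; lra).
      apply Rlt_le_trans with (rho (F 0)); [apply (proj1 Hrho), HFD, H0|apply HM, H0]. }
    assert (Hhold : forall h s t, 0 < h < d -> Rabs (s - t) < h ->
       Cmod (F (polar 1 s) - F (polar 1 t)) <= K * Rpower h alpha / c).
    { intros h s t Hh Hst. rewrite <- !boundary_function_polar.
      assert (Hs := proj1 (modulus_le_iff D rho _ h _ Hrho HD Hb (proj1 Hh)) (HK h Hh) s t Hst).
      rewrite Rabs_pos_eq in Hs by (left; apply Rpower_pos).
      eapply Rle_trans; [apply (euclidean_le_rho_dist D rho Hrho HD c Hc Hlb); apply Hb|].
      apply Rmult_le_compat_r; [left; apply Rinv_0_lt_compat, Hc|exact Hs]. }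
    (* [3/4] is required by [derive_bound_of_boundary]; [1 - d] makes [h = 1 - |z|] admissible in
       [Hhold]. *)
    set (r0 := Rmax (3 / 4) (1 - d)).
    assert (B1 : 3 / 4 <= r0) by apply Rmax_l. assert (B2 : 1 - d <= r0) by apply Rmax_r.
    assert (B3 : r0 < 1) by (apply Rmax_lub_lt; lra).
    assert (HFder : forall z : C, disk z -> forall l, is_derive f z l -> is_derive F z l).
    { intros z Hz l Hl. apply (is_derive_ext_loc (K := C_AbsRing) (V := C_NormedModule) f); [|exact Hl].
      apply locally_C, locally_Cmod. exists (1 - Cmod z). unfold disk in Hz. split; [lra|].
      intros w Hw. symmetry; apply HF. unfold disk.
      generalize (Cmod_triangle (w - z) z). replace (w - z + z)%C with w by ring. lra. }
    (* [M] bounds [rho o F], [K / c] is the Euclidean Hoelder constant and [8] comes from the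
       derivative bound. *)
    exists (Rmax 0 (8 * M * K / c)), r0. split; [apply Rmax_l|]. split; [lra|].
    intros z l Hz Hl. assert (Dz : disk z) by (unfold disk; lra).
    set (h := 1 - Cmod z). assert (Hh : 0 < h < d) by (unfold h; lra).
    assert (Hle : Cmod l <= 8 * (K * Rpower h alpha / c) / h).
    { apply (derive_bound_of_boundary F z l); [exact HFc| |lra| |apply HFder; assumption].
      - intros w Hw. destruct (proj2 Hf w Hw) as [m Hm]. exists m. apply HFder; assumption.
      - intros s t Hst. apply Hhold; [exact Hh|exact Hst]. }
    apply Rle_trans with (M * (8 * (K * Rpower h alpha / c) / h)).
    + apply Rmult_le_compat; [left; apply (proj1 Hrho), (proj1 Hf), Dz|apply Cmod_ge_0| |exact Hle].
      rewrite <- HF by exact Dz. apply HM. unfold closed_disk. lra.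
    + rewrite <- (Rpower_pred h alpha) by lra.
      replace (M * (8 * (K * (Rpower h (alpha - 1) * h) / c) / h)) with
        (8 * M * K / c * Rpower h (alpha - 1)) by (field; lra).
      apply Rmult_le_compat_r; [left; apply Rpower_pos|apply Rmax_r].
Qed.
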